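(* Let $\Pi$ be a symmetric node-edge-checkable LCL problem on undirected paths without input. If $\Pi$ can be solved in $O(\log^* n)$ rounds in the LOCAL model, then there exists an LCL problem $\Pi'$ on undirected paths with the same asymptotic round complexity as $\Pi$ in the LOCAL model, such that every solution of $\Pi'$ is also a solution of $\Pi$, and $\Pi'$ is $O(1)$-mendable.
   Context: A node-edge-checkable LCL on paths is a tuple $\Pi=(\Gamma,C_{\mathrm{edge}},C_{\mathrm{node}},C_{\mathrm{start}},C_{\mathrm{end}})$ with $\Gamma$ a finite set of labels, $C_{\mathrm{edge}},C_{\mathrm{node}}\subseteq\Gamma\times\Gamma$ and $C_{\mathrm{start}},C_{\mathrm{end}}\subseteq\Gamma$; each node outputs one label per incident edge (half-edge labels), the pair of labels at every degree-2 node must lie in $C_{\mathrm{node}}$, the pair of labels on the two halves of every edge must lie in $C_{\mathrm{edge}}$, and the labels at the two endpoints of the path must satisfy $C_{\mathrm{start}}$ and $C_{\mathrm{end}}$ respectively. $\Pi$ is symmetric if $C_{\mathrm{start}}=C_{\mathrm{end}}$ and $C_{\mathrm{edge}}$, $C_{\mathrm{node}}$ are symmetric relations. In general, an LCL problem is given by finite label sets and a verifier $\psi$ of constant radius $r$ whose verdict (happy/unhappy) at a node depends only on its labeled radius-$r$ neighborhood; a solution makes $\psi$ happy everywhere. For partial labelings with empty label $\bot$, the relaxed verifier $\psi^*$ is happy at $v$ if some node within distance $r$ of $v$ has label $\bot$, and otherwise agrees with $\psi$ on any completion. A $t$-mend of a $\psi^*$-accepted partial labeling $\lambda$ at $v$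 is a $\psi^*$-accepted partial labeling $\mu$ with $\mu(v)\neq\bot$, $\mu(u)=\bot\Rightarrow\lambda(u)=\bot$, and $\mu(u)\neq\lambda(u)\Rightarrow\mathrm{dist}(u,v)\le t$. $\Pi'$ is $O(1)$-mendable if some radius-$r$ verifier for $\Pi'$ (accepting exactly its solutions) admits a constant $t$ such that on every graph of the family, for every $\psi^*$-accepted partial labeling and every node $v$, a $t$-mend at $v$ exists. LOCAL model: nodes with unique identifiers communicate along edges in synchronous rounds with unbounded messages; round complexity is the number of rounds needed to output a valid solution. *)

(* Defs.v *)
From mathcomp Require Import all_boot.
Set Implicit Arguments. Unset Strict Implicit. Unset Printing Implicit Defensive.

(* Paths.  A path with n >= 1 nodes is identified with positions 0..n-1,    *)
(* p adjacent to p+1.  Functions on positions are given as nat -> _ ; only  *)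
(* values at positions < n are meaningful.  A (half-edge) output labeling   *)
(* gives every node p a pair (label on half-edge towards p-1,               *)
(*                            label on half-edge towards p+1).             *)
(* Components for non-existing half-edges (at endpoints) are ignored.      *)

Definition swap {A : Type} (x : A * A) : A * A := (x.2, x.1).

(* radius-r window around v, in geometric order; None = no node there *)
Definition win {A : Type} (n r v : nat) (f : nat -> A) : seq (option A) :=
  [seq (if (r <= v + d) && (v + d - r < n) then Some (f (v + d - r)) else None)
  | d <- iota 0 r.*2.+1].

Definition dist (u v : nat) : nat := (u - v) + (v - u).

Record nec (G : finType) := Nec {
  C_edge : rel G; C_node : rel G; C_start : pred G; C_end : pred G }.

Definition nec_symmetric (G : finType) (P : nec G) : Prop :=
  (forall x, C_start P x = C_end P x) /\ symmetric (C_edge P) /\ symmetric (C_node P).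

Definition nec_sol (G : finType) (P : nec G) (n : nat) (lab : nat -> G * G) : Prop :=
  (forall p, 0 < p -> p.+1 < n -> C_node P (lab p).1 (lab p).2) /\
  (forall p, p.+1 < n -> C_edge P (lab p).2 (lab p.+1).1) /\
  (1 < n -> C_start P (lab 0).2 /\ C_end P (lab n.-1).1).

(* what a verifier sees of a node: its existing half-edge labels *)
Definition mask (G : Type) (n p : nat) (x : G * G) : option G * option G :=
  (if p == 0 then None else Some x.1, if p == n.-1 then None else Some x.2).

Definition verifier (G : finType) := seq (option (option G * option G)) -> bool.

(* undirected: the verdict does not depend on the orientation of the window *)
Definition verifier_sym (G : finType) (psi : verifier G) : Prop :=
  forall w, psi (rev (map (omap swap) w)) = psi w.

Definition lwin (G : finType) (n r v : nat) (lab : nat -> G * G) :=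
  win n r v (fun p => mask n p (lab p)).

Definition accepts (G : finType) (r : nat) (psi : verifier G) (n : nat)
    (lab : nat -> G * G) : Prop :=
  forall v, v < n -> psi (lwin n r v lab).

Record lcl (G : finType) := Lcl {
  lcl_r : nat; lcl_psi : verifier G; lcl_sym : verifier_sym lcl_psi }.

Definition lcl_sol (G : finType) (P : lcl G) (n : nat) (lab : nat -> G * G) : Prop :=
  accepts (lcl_r P) (lcl_psi P) n lab.

(* partial labeling: None = the empty label bottom *)
Definition pwin (G : finType) (n r v : nat) (lam : nat -> option (G * G)) :=
  win n r v (fun p => omap (mask n p) (lam p)).

(* relaxed verifier psi^* : happy if a bottom is within distance r,
   otherwise the verdict of psi on the (fully labeled) window *)
Definition psi_star (G : finType) (psi : verifier G)
    (w : seq (option (option (option G * option G)))) : bool :=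
  has (pred1 (Some None)) w || psi (map (fun e => obind id e) w).

Definition star_accepts (G : finType) (r : nat) (psi : verifier G) (n : nat)
    (lam : nat -> option (G * G)) : Prop :=
  forall v, v < n -> psi_star psi (pwin n r v lam).

Definition is_mend (G : finType) (r : nat) (psi : verifier G) (t n : nat)
    (lam mu : nat -> option (G * G)) (v : nat) : Prop :=
  [/\ star_accepts r psi n mu, mu v <> None,
      (forall u, u < n -> mu u = None -> lam u = None) &
      (forall u, u < n -> mu u <> lam u -> dist u v <= t)].

Definition O1_mendable (G : finType) (P : lcl G) : Prop :=
  exists (r : nat) (psi : verifier G),
    [/\ verifier_sym psi,
        (forall n lab, 0 < n -> (accepts r psi n lab <-> lcl_sol P n lab)) &
        exists t : nat, forall n (lam : nat -> option (G * G)), 0 < n ->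
          star_accepts r psi n lam ->
          forall v, v < n -> exists mu, is_mend r psi t n lam mu v].

Definition valid_ids (c n : nat) (ids : nat -> nat) : Prop :=
  (forall p q, p < n -> q < n -> ids p = ids q -> p = q) /\
  (forall p, p < n -> 0 < ids p <= n ^ c).

(* An algorithm maps (n, view) to a pair of half-edge labels.  The view of
   node p after T(n) rounds is the window of IDs of radius T(n) around p;
   since the path is undirected, the adversary chooses (via o p) in which
   orientation node p sees it (port numbering), and the output pair is
   interpreted in that same orientation. *)
Definition orientw {A : Type} (b : bool) (w : seq A) := if b then rev w else w.
Definition orient {A : Type} (b : bool) (x : A * A) := if b then swap x else x.

Definition run (G : Type) (A : nat -> seq (option nat) -> G * G) (T : nat -> nat)
    (n : nat) (ids : nat -> nat) (o : nat -> bool) : nat -> G * G :=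
  fun p => orient (o p) (A n (orientw (o p) (win n (T n) p ids))).

Definition solvable_in (G : finType) (c : nat) (P : nat -> (nat -> G * G) -> Prop)
    (T : nat -> nat) : Prop :=
  exists A : nat -> seq (option nat) -> G * G,
    forall n ids (o : nat -> bool), 0 < n -> valid_ids c n ids ->
      P n (run A T n ids o).

Definition bigO (T f : nat -> nat) : Prop := exists C, forall n, T n <= C * (f n).+1.

Definition solvable_O (G : finType) (c : nat) (P : nat -> (nat -> G * G) -> Prop)
    (f : nat -> nat) : Prop :=
  exists T, bigO T f /\ solvable_in c P T.

Fixpoint ls_fuel (k n : nat) : nat :=
  match k with
  | 0 => 0
  | k'.+1 => if n <= 1 then 0 else (ls_fuel k' (trunc_log 2 n)).+1
  end.
Definition log_star (n : nat) : nat := ls_fuel n n.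

(* Main.v *)
(* A state is the pair of labels of a node.  Call it good when it is joined to
   itself and to its mirror image by walks of every large length and can be
   reached from an endpoint; P' is P with the labels away from the endpoints
   confined to the mirror-closed strongly connected class S of a good state w.
   As any two states of S are joined by walks of every large length, P' can be
   mended by rewriting a window of constant size.

   The output of any algorithm far from the endpoints is good when the path is
   long compared with the radius T, since its view and a disjoint one can be
   placed at any distance in any orientation.  Hence good states exist.

   To solve P', give the nodes keys that are distinct within distance 2k, and
   call peaks the nodes whose key is maximal within distance k.  The side of the
   largest key in sight does not change along the path until a peak is met, so
   the path splits into long stretches directed towards peaks, separated by peaks
   and by valleys where the direction changes.  Peaks and valleys are anchors
   labelled w or its mirror image, and the stretches between them are filled by
   walks.
   - If some good w can follow itself, identifiers serve as keys: a stretch of any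
     length is filled by repeating w, in constant time.
   - Otherwise adjacent outputs of an algorithm for P are distinct states, up to a
     facing orientation that comparing identifiers detects, which gives a colouring
     with constantly many colours.  The algorithm works on any sequence of distinct
     identifiers, so it can be run on every arithmetic progression of nodes of
     difference at most 2k; the product of these colours is a key taking few
     values, which makes every stretch visible within O(T) rounds.  This reduction
     replaces a lower bound on T. *)
Require Import Defs.
From Stdlib Require Import ZArith ClassicalEpsilon.
From mathcomp Require Import all_boot zify.
Set Implicit Arguments. Unset Strict Implicit. Unset Printing Implicit Defensive.

(** * Walks of half-edge labels *)

Definition asbool (Q : Prop) : bool := if excluded_middle_informative Q then true else false.

(* Hypotheses about finite types make the preprocessing of [lia] explode. *)
Ltac nlia := repeat match goal with
  | H : is_true ?b |- _ =>
    lazymatch b with leq _ _ => fail | andb (leq _ _) _ => fail | _ => clear H end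
  | H : connect _ _ _ = _ |- _ => clear H
  | H := _ : pred _ |- _ => clearbody H end; lia.

Lemma asboolP (Q : Prop) : reflect Q (asbool Q).
Proof. by rewrite /asbool; case: excluded_middle_informative => h; constructor. Qed.

Lemma swapK (A : Type) : involutive (@swap A).
Proof. by case. Qed.

Section Walks.
Variables (G : finType) (P : nec G).
Hypothesis symP : nec_symmetric P.

Lemma edgeC x y : C_edge P x y = C_edge P y x.
Proof. by case: symP => _ [h _]; rewrite h. Qed.

Lemma nodeC x y : C_node P x y = C_node P y x.
Proof. by case: symP => _ [_ h]; rewrite h. Qed.

Definition nodeok (s : G * G) := C_node P s.1 s.2.
Definition link (s s' : G * G) := C_edge P s.2 s'.1.
Definition step : rel (G * G) := fun s s' => [&& nodeok s, nodeok s' & link s s'].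

Lemma nodeok_swap s : nodeok (swap s) = nodeok s.
Proof. by rewrite /nodeok /= nodeC. Qed.

Lemma link_swap s s' : link (swap s') (swap s) = link s s'.
Proof. by rewrite /link /= edgeC. Qed.

Lemma step_swap s s' : step (swap s') (swap s) = step s s'.
Proof. by rewrite /step !nodeok_swap link_swap; case: (nodeok s); case: (nodeok s'). Qed.

Definition walk m x y := exists f : nat -> G * G,
  [/\ f 0 = x, f m = y & forall i, i < m -> step (f i) (f i.+1)].

Lemma walk0 x : walk 0 x x.
Proof. by exists (fun=> x). Qed.

Lemma glue_walk (R : rel (G * G)) a b (f g : nat -> G * G) : f a = g 0 ->
  (forall i, i < a -> R (f i) (f i.+1)) -> (forall i, i < b -> R (g i) (g i.+1)) ->
  forall i, i < a + b ->
  let h i := if i <= a then f i else g (i - a) in R (h i) (h i.+1).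
Proof.
move=> e hf hg i hi /=; case: (leqP i.+1 a) => h.
  by rewrite (ltnW h); exact: hf.
have {h} h : a <= i by [].
case: (leqP i a) => h'.
  have ->: i = a by lia.
  rewrite e; have ->: a.+1 - a = 1 by lia.
  by apply: hg; lia.
by rewrite subSn //; apply: hg; lia.
Qed.

Lemma walk_cat a b x y z : walk a x y -> walk b y z -> walk (a + b) x z.
Proof.
case=> f [f0 fa hf] [g [g0 gb hg]].
exists (fun i => if i <= a then f i else g (i - a)); split => //.
- case: leqP => h; last by rewrite addKn.
  have b0 : b = 0 by lia.
  by rewrite -gb b0 addn0 fa -g0.
- by apply: (glue_walk (R := step)) => //; rewrite fa g0.
Qed.

Lemma walk_rev m x y : walk m x y -> walk m (swap y) (swap x).
Proof.
case=> f [f0 fm hf]; exists (fun i => swap (f (m - i))); split.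
- by rewrite subn0 fm.
- by rewrite subnn f0.
- move=> i hi; rewrite step_swap (_ : m - i = (m - i.+1).+1); last by lia.
  by apply: hf; lia.
Qed.

Lemma walk_connect m x y : walk m x y -> connect step x y.
Proof.
case=> f [<- <- hf]; elim: m hf => [|m IH] hf; first exact: connect0.
apply: (connect_trans (IH _)); first by move=> i hi; apply: hf; lia.
by apply: connect1; apply: hf.
Qed.

Lemma connect_walk x y : connect step x y -> exists2 m, m <= #|{: G * G}| & walk m x y.
Proof.
case/connectP=> p /shortenP [q pq uq _] ->; exists (size q).
  have := max_card (mem (x :: q)); rewrite (card_uniqP uq) /=; lia.
exists (nth x (x :: q)); split => //; first by rewrite nth_last.
by move=> i hi; apply/(pathP x).
Qed.

Lemma connect_swap x y : connect step x y -> connect step (swap y) (swap x).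
Proof. by case/connect_walk => m _ /walk_rev /walk_connect. Qed.

Definition flexible (w w' : G * G) := exists M, forall m, M <= m -> walk m w w'.

(** [L] and [L.+1] are coprime, so every length from [L * L] on is a sum of copies of the two. *)
Lemma flexible_loop L w : walk L w w -> walk L.+1 w w -> 0 < L -> flexible w w.
Proof.
move=> h h1 L0; exists (L * L) => m hm.
have mulw : forall k K, walk K w w -> walk (k * K) w w.
  elim=> [|k IH] K hK; first exact: walk0.
  by rewrite mulSn; exact: walk_cat hK (IH _ hK).
have q : L <= m %/ L by rewrite leq_divRL.
have r := ltn_pmod m L0.
have {}q : m %% L <= m %/ L by exact: leq_trans (ltnW r) q.
rewrite (divn_eq m L); move: (m %/ L) (m %% L) q => a b hab.
(* The quotient [a] is at least the remainder [b], so [b] of the [a] loops can be lengthened by one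
   to absorb the remainder. *)
have ->: a * L + b = (a - b) * L + b * L.+1.
  by rewrite -{1}(subnK hab) mulnDl mulnS; lia.
by apply: walk_cat; apply: mulw.
Qed.

Lemma flexible_cat m x y z : walk m x y -> flexible y z -> flexible x z.
Proof.
move=> h [M hM]; exists (m + M) => k hk; have ->: k = m + (k - m) by lia.
by apply: walk_cat h _; apply: hM; lia.
Qed.

Definition good (w : G * G) :=
  [/\ nodeok w, flexible w w, flexible w (swap w), flexible (swap w) w &
      exists x s, [/\ C_start P x, C_edge P x s.1, nodeok s & connect step s w]].

(* [S] is the mirror-closed strongly connected component of a flexible state;
   [x0] a start label from which [S] is entered. *)
Record hub (w : G * G) (S : pred (G * G)) (M : nat) (x0 : G) : Prop := Hub {
  hub_w : S w;
  hub_node : forall s, S s -> nodeok s;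
  hub_swap : forall s, S s -> S (swap s);
  hub_start : C_start P x0;
  hub_in : forall m s s', M <= m -> S s -> S s' -> exists f : nat -> G * G,
    [/\ f 0 = s, f m = s', (forall i, i <= m -> S (f i)) &
        (forall i, i < m -> link (f i) (f i.+1))];
  hub_enter : forall m s, M <= m -> S s -> exists f : nat -> G * G,
    [/\ f 0 = (x0, x0), f m = s, (forall i, 0 < i <= m -> nodeok (f i)),
        (forall i, i < m -> link (f i) (f i.+1)) & (forall i, M <= i <= m -> S (f i))] }.

(** A walk of prescribed length goes to [w], spends the surplus on a closed walk at [w], and leaves;
    [connect_walk] bounds the two short parts uniformly. *)
Lemma good_hub w : good w -> exists S M x0, 0 < M /\ hub w S M x0.
Proof.
case=> nw [M1 f1] [M2 f2] [M3 f3] [x0 [s0 [hx0 xs0 ns0 cs0]]].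
pose S := [pred s | [&& nodeok s, connect step w s & connect step s w]].
have Sw : S w by rewrite /= nw !connect0.
have c1 := walk_connect (f2 _ (leqnn _)); have c2 := walk_connect (f3 _ (leqnn _)).
have Ssw s : S s -> S (swap s).
  case/and3P => ns h1 h2; apply/and3P; split; first by rewrite nodeok_swap.
  (* Mirroring reverses walks: [s] to [w] becomes [swap w] to [swap s], and [c1] joins [w] to
     [swap w]. *)
  - by apply: (connect_trans c1); exact: connect_swap.
  - by apply: connect_trans (connect_swap h1) c2.
have [N cwalk] : exists N, forall x y, connect step x y -> exists2 m, m <= N & walk m x y.
  by exists #|{: G * G}| => x y; exact: connect_walk.
pose M0 := M1 + N + N.
have inS m s s' : M0 <= m -> S s -> S s' -> exists f : nat -> G * G,
    [/\ f 0 = s, f m = s', (forall i, i <= m -> S (f i)) &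
        (forall i, i < m -> link (f i) (f i.+1))].
  move=> hm Ss Ss'; case/and3P: (Ss) => ns ws sw; case/and3P: (Ss') => ns' ws' sw'.
  have [a ha wa] := cwalk _ _ sw; have [b hb wb] := cwalk _ _ ws'.
  have: walk (a + (m - a - b) + b) s s'.
    apply: walk_cat wb.
    apply: walk_cat wa _.
    apply: f1.
    rewrite /M0 in hm.
    nlia.
  have ->: a + (m - a - b) + b = m by rewrite /M0 in hm; nlia.
  case=> f [f0 fm hf]; exists f; split => //; last by move=> i /hf /and3P[].
  move=> i hi; apply/and3P; split.
  - case: (ltnP i m) => h; first by case/and3P: (hf _ h).
    by have ->: i = m by [nlia]; rewrite fm.
  - apply: connect_trans ws _; apply: (@walk_connect i).
    by exists f; split => // j hj; apply: hf; nlia.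
  - apply: connect_trans _ sw'; apply: (@walk_connect (m - i)).
    exists (fun j => f (i + j)); split; rewrite ?addn0 ?subnKC // => j hj.
    by rewrite addnS; apply: hf; nlia.
have [a ha [g [g0 ga hg]]] := cwalk _ _ cs0.
(* [a.+1] steps lead from the endpoint to [w], one for the first edge and [a] for the walk from
   [s0]; [M0] more reach any state of [S]. *)
pose M := a.+1 + M0.
exists S, M, x0; split; first by []; split => //.
- by move=> s /and3P[].
- by move=> m s s' hm; apply: inS; rewrite /M in hm; nlia.
- move=> m s hm Ss.
  have [| f [e0 em fS hf]] := inS (m - a.+1) w s _ Sw Ss; first by rewrite /M in hm; nlia.
  (* The endpoint receives the pair [(x0, x0)], of which the first edge meets only the second
     half. *)
  pose g' i := if i is j.+1 then g j else (x0, x0).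
  exists (fun i => if i <= a.+1 then g' i else f (i - a.+1)); split => //.
  + case: leqP => h //.
    have q : m = a.+1 by rewrite /M in hm; nlia.
    by rewrite -em q subnn e0 /= ga.
  + move=> i /andP[i0 im]; case: leqP => h; last by case/and3P: (fS (i - a.+1) ltac:(nlia)).
    case: i i0 im h => // i _ _ h /=.
    case: (ltnP i a) => h'; first by case/and3P: (hg _ h').
    have ->: i = a by nlia.
    by rewrite ga.
  + move=> i hi; rewrite /M in hm.
    apply: (glue_walk (R := link) (a := a.+1) (b := m - a.+1) (f := g') (g := f)) => //.
    * by rewrite /= ga.
    * case=> [|j] hj /=; first by rewrite /link /= g0.
      by case/and3P: (hg j hj).
    * by nlia.
  + move=> i /andP[hi hi']; rewrite /M in hi; case: leqP => h; last by apply: fS; nlia.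
    have ->: i = a.+1 by rewrite /M0 in hi; nlia.
    by rewrite /g' ga.
Qed.
End Walks.

(** * The restricted problem and its verifier *)

Section Windows.
Variables (A : Type) (n r : nat).

Lemma size_win v (f : nat -> A) : size (win n r v f) = r.*2.+1.
Proof. by rewrite size_map size_iota. Qed.

Lemma nth_win v (f : nat -> A) i : i < r.*2.+1 ->
  nth None (win n r v f) i =
  if (r <= v + i) && (v + i - r < n) then Some (f (v + i - r)) else None.
Proof. by move=> hi; rewrite (nth_map 0) ?size_iota // nth_iota. Qed.

Lemma win_ext v (f g : nat -> A) : (forall p, p < n -> f p = g p) -> win n r v f = win n r v g.
Proof. by move=> e; apply: eq_map => d; case: ifP => // /andP[_ /e ->]. Qed.

Lemma win_rev v (f : nat -> A) : v < n ->
  rev (win n r v f) = win n r (n.-1 - v) (fun p => f (n.-1 - p)).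
Proof.
move=> hv; apply: (@eq_from_nth _ None); first by rewrite size_rev !size_win.
move=> i; rewrite size_rev size_win => hi.
rewrite nth_rev size_win // !nth_win; try lia.
case: ifP => h1; case: ifP => h2 //; try lia.
by congr (Some (f _)); lia.
Qed.
End Windows.

Lemma map_win (A B : Type) n r v (f : nat -> A) (h : A -> B) :
  map (omap h) (win n r v f) = win n r v (fun p => h (f p)).
Proof. by rewrite /win -map_comp; apply: eq_map => d /=; case: ifP. Qed.

Lemma swap_mask (G : Type) n p (x : G * G) : p < n ->
  swap (Defs.mask n p x) = Defs.mask n (n.-1 - p) (swap x).
Proof.
move=> hp; rewrite /Defs.mask /swap /=; have ->: (n.-1 - p == 0) = (p == n.-1) by lia.
by have ->: (n.-1 - p == n.-1) = (p == 0) by lia.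
Qed.

Section Restricted.
Variables (G : finType) (P : nec G) (S : pred (G * G)) (R : nat).
Hypotheses (symP : nec_symmetric P) (S_swap : forall s, S s -> S (swap s)) (R0 : 0 < R).

(** Tests the node, a left endpoint and the right edge; [restr_psi] adds the same test on the
    mirrored window, which makes the verdict symmetric by construction. Membership in [S] is asked
    only when the window does not stick out of the path. *)
Definition half_check (w : seq (option (option G * option G))) : bool :=
  if nth None w R is Some (l, r) then
    [&& match l, r with
        | Some a, Some b => C_node P a b && (all isSome w ==> S (a, b))
        | None, Some b => C_start P b
        | _, _ => true
        end &
        match r, nth None w R.+1 with
        | Some b, Some (Some a, _) => C_edge P b a
        | _, _ => true
        end]
  else false.

Definition restr_psi : verifier G :=
  fun w => half_check w && half_check (rev (map (omap swap) w)).

Lemma restr_sym : verifier_sym restr_psi.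
Proof.
move=> w; rewrite /restr_psi andbC map_rev revK -map_comp map_id_in //.
by case=> //= x _; rewrite swapK.
Qed.

Definition restr : lcl G := Lcl R restr_sym.

Definition checked n (lab : nat -> G * G) v : Prop :=
  [/\ (0 < v -> v.+1 < n -> nodeok P (lab v)),
      (v = 0 -> 1 < n -> C_start P (lab v).2) /\
      (v.+1 = n -> 1 < n -> C_start P (lab v).1),
      (v.+1 < n -> link P (lab v) (lab v.+1)),
      (0 < v -> link P (lab v.-1) (lab v)) &
      (R <= v -> v + R < n -> S (lab v))].

Lemma all_win (A : Type) n v (f : nat -> A) : v < n ->
  all isSome (win n R v f) = (R <= v) && (v + R < n).
Proof.
move=> hv; apply/idP/idP => [/(all_nthP None) h|h].
  have := h 0; have := h R.*2; rewrite !size_win !nth_win; try lia.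
  by case: ifP => [?|_ /(_ (leqnn _))]; case: ifP => [?|_ _ /(_ isT)] // _ _; lia.
apply/(all_nthP None) => i; rewrite size_win => hi; rewrite nth_win //.
by case: ifP => //; lia.
Qed.

Lemma half_checkP n v lab : v < n ->
  half_check (lwin n R v lab) <->
  [/\ (0 < v -> v.+1 < n -> nodeok P (lab v)), (v = 0 -> 1 < n -> C_start P (lab v).2),
      (v.+1 < n -> link P (lab v) (lab v.+1)) &
      (R <= v -> v + R < n -> S (lab v))].
Proof.
move=> hv; rewrite /half_check /lwin all_win // !nth_win; try lia.
rewrite addnK hv leq_addl /= (_ : (R <= v + R.+1) && (v + R.+1 - R < n) = (v.+1 < n)); last by lia.
rewrite (_ : v + R.+1 - R = v.+1); last by lia.
have q x : (x == n.-1) = (x.+1 == n) by lia.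
rewrite /Defs.mask !q /nodeok /link; case: v hv => [|v] hv /=.
- case: eqP => h1 /=.
    by split=> // _; split=> // *; lia.
  have h: 1 < n by lia.
  rewrite h /=; split=> [/andP[a b]|[_ a b _]]; first by split=> // *; lia.
  by rewrite a ?b.
- case: eqP => h1 /=; first by split=> // _; split=> // *; lia.
  have h: v.+2 < n by lia.
  rewrite h /=; split=> [/andP[/andP[a /implyP b] c]|[a _ b c]].
    by split=> // *; rewrite [lab v.+1]surjective_pairing; apply: b; apply/andP.
  rewrite a // b // andbT; apply/implyP => /andP[h2 h3].
  by rewrite -surjective_pairing; apply: c.
Qed.

Lemma restr_psiP n v lab : v < n -> restr_psi (lwin n R v lab) <-> checked n lab v.
Proof.
move=> hv; rewrite /restr_psi.
(* The mirrored window of [v] is the window of the mirrored node on the mirrored path. *)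
have ->: rev (map (omap swap) (lwin n R v lab)) = lwin n R (n.-1 - v) (fun p => swap (lab (n.-1 - p))).
  by rewrite /lwin map_win win_rev //; apply: win_ext => p hp; rewrite swap_mask ?subKn //; lia.
have nv : n.-1 - v < n by lia.
have e : n.-1 - (n.-1 - v) = v by lia.
split.
- case/andP => /half_checkP-/(_ hv)[a b c d] /half_checkP-/(_ nv)[a' b' c' d'].
  split=> //; first by split=> // h1 h2; rewrite e in b'; apply: b'; lia.
  move=> v0; rewrite -(link_swap symP); move: c'; rewrite e.
  have ->: n.-1 - (n.-1 - v).+1 = v.-1 by lia.
  by apply; lia.
- case=> a [b b'] c c' d; apply/andP; split; apply/half_checkP => //; split; rewrite ?e => *.
  + by rewrite nodeok_swap // a //; lia.
  + by apply: b'; lia.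
  + have ->: n.-1 - (n.-1 - v).+1 = v.-1 by lia.
    by rewrite link_swap // c' //; lia.
  + by apply: S_swap; apply: d; lia.
Qed.

Lemma restr_solP n lab : lcl_sol restr n lab <-> forall v, v < n -> checked n lab v.
Proof. by split=> h v hv; have := h v hv; rewrite restr_psiP. Qed.

Lemma restr_sol_nec n lab : 0 < n -> lcl_sol restr n lab -> nec_sol P n lab.
Proof.
move=> n0 /restr_solP h; split; [|split].
- by move=> p p0 hp; have [a _ _ _ _] := h p (ltnW hp); apply: a.
- by move=> p hp; have [_ _ a _ _] := h p (ltnW hp); apply: a.
- move=> n1; have [_ [a _] _ _ _] := h 0 n0; split; first exact: a.
  have [_ [_ b] _ _ _] := h n.-1 ltac:(lia).
  by case: symP => e _; rewrite -e; apply: b => //; lia.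
Qed.

Lemma restr_sol_ext n lab lab' : (forall p, p < n -> lab p = lab' p) ->
  lcl_sol restr n lab -> lcl_sol restr n lab'.
Proof.
move=> e h v hv; have := h v hv.
by rewrite /lwin (@win_ext _ _ _ _ _ (fun p => Defs.mask n p (lab' p))) // => p /e ->.
Qed.

Definition has_hole n (lam : nat -> option (G * G)) v :=
  exists u, [/\ u < n, u <= v + R, v <= u + R & lam u = None].

(** Without a hole in sight the default [g0] is never read. *)
Lemma star_checkP n lam v g0 : v < n ->
  psi_star restr_psi (pwin n R v lam) <->
  has_hole n lam v \/ checked n (fun p => odflt g0 (lam p)) v.
Proof.
move=> hv; rewrite /psi_star.
have hP : has (pred1 (Some None)) (pwin n R v lam) <-> has_hole n lam v.
  split.
  - case/(has_nthP None) => i; rewrite size_win => hi; rewrite nth_win //.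
    case: ifP => // /andP[h1 h2] /= /eqP [] h; exists (v + i - R); split; try lia.
    by case: (lam _) h.
  - case=> u [hu h1 h2 h3]; apply/(has_nthP None); exists (u + R - v); rewrite ?size_win; first lia.
    rewrite nth_win; last lia.
    have ->: v + (u + R - v) - R = u by lia.
    by case: ifP; [rewrite h3 /= eqxx | lia].
case: (boolP (has _ _)) => h; rewrite ?orFb; first by split=> // _; left; apply/hP.
rewrite -restr_psiP //.
rewrite [X in restr_psi X <-> _](_ : _ = lwin n R v (fun p => odflt g0 (lam p))); last first.
  rewrite /pwin /lwin /win -map_comp; apply/eq_in_map => d; rewrite mem_iota => hd /=.
  case: ifP => // /andP[h1 h2] /=; case e: (lam _) => //=.
  by case/negP: h; apply/hP; exists (v + d - R); split=> //; lia.
split; first by right.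
by case=> // /hP; rewrite (negPf h).
Qed.
End Restricted.

(** * Mending *)

Section Bridges.
Variables (G : finType) (P : nec G) (w : G * G) (S : pred (G * G)) (M : nat) (x0 : G).
Hypotheses (symP : nec_symmetric P) (hubS : hub P w S M x0).

(* [None] stands for an endpoint of the path, labelled [(x0, x0)]. *)
Definition anchor_val (a : option (G * G)) : G * G := odflt (x0, x0) a.
Definition anchor_ok (a : option (G * G)) : Prop := if a is Some s then S s else True.

(** Merges the two hub clauses, so that an endpoint and an inner anchor serve alike as the source of
    a walk. *)
Lemma arrive t s m : anchor_ok t -> S s -> M <= m -> exists f : nat -> G * G,
  [/\ f 0 = anchor_val t, f m = s, (forall i, i < m -> link P (f i) (f i.+1)),
      (forall i, 0 < i <= m -> nodeok P (f i)) &
      (forall i, i <= m -> (t = None -> M <= i) -> S (f i))].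
Proof.
move=> ht hs hm; case: t ht => [s'|] ht.
  have [f [f0 fm fS fl]] := hub_in hubS hm ht hs; exists f; split=> //.
    by move=> i /andP[_ hi]; apply: (hub_node hubS); exact: fS.
  by move=> i hi _; exact: fS.
have [f [f0 fm fn fl fS]] := hub_enter hubS hm hs; exists f; split=> //.
by move=> i hi /(_ erefl) h; apply: fS; rewrite h.
Qed.

(** The first [M] steps lead from [t] to [w]; the rest is the mirror image of a walk from the
    mirrored [h] to [swap w]. Both parts start at an anchor, so no walk has to end in an
    endpoint. *)
Lemma bridge t h g : anchor_ok t -> anchor_ok h -> M.*2 <= g -> exists f : nat -> G * G,
  [/\ f 0 = anchor_val t, f g = anchor_val h, (forall i, i < g -> link P (f i) (f i.+1)),
      (forall i, 0 < i < g -> nodeok P (f i)) &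
      (forall i, i <= g -> (t = None -> M <= i) -> (h = None -> i + M <= g) -> S (f i))].
Proof.
move=> ht hh hg.
have [f [f0 fm fl fn fS]] := arrive ht (hub_w hubS) (leqnn M).
have hh' : anchor_ok (omap (@swap G) h) by case: h hh => //= s; exact: (hub_swap hubS).
have gM : M <= g - M by lia.
have [f' [f0' fm' fl' fn' fS']] := arrive hh' (hub_swap hubS (hub_w hubS)) gM.
exists (fun i => if i <= M then f i else swap (f' (g - M - (i - M)))); split.
- by [].
- case: leqP => hc.
    (* Here [g <= M], which with [M.*2 <= g] forces both to be 0. *)
    have z : g = M by lia.
    have z0 : g - M = 0 by lia.
    rewrite z fm; move: fm'; rewrite z0 f0'; case: (h) => [s|] /=; last by case: (w) => a b [-> ->].
    by move/(congr1 (@swap G)); rewrite !swapK.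
  by rewrite subnn f0'; case: (h) => [s|] //=; rewrite swapK.
- move=> i hi.
  apply: (glue_walk (R := link P) (a := M) (b := g - M) (f := f) (g := fun j => swap (f' (g - M - j)))) => //.
  + by rewrite subn0 fm fm' swapK.
  + move=> j hj; rewrite link_swap //.
    by rewrite (_ : g - M - j = (g - M - j.+1).+1); [apply: fl'; lia | lia].
  + by lia.
- move=> i /andP[i0 ig]; case: leqP => hc; first by apply: fn; rewrite i0.
  by rewrite nodeok_swap //; apply: fn'; lia.
- move=> i ig h1 h2; case: leqP => hc; first by apply: fS.
  by apply: (hub_swap hubS); apply: fS'; [lia | case: (h) h2 => //= /(_ erefl); lia].
Qed.

Variable R : nat.
Hypotheses (MR : M.*2 <= R) (R0 : 0 < R).
Hypothesis solvP : forall n, 0 < n -> exists lab, nec_sol P n lab.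

Let psi := restr_psi P S R.
Let checked := checked P S R.

Lemma checked_ext n f g y : f y = g y -> (0 < y -> f y.-1 = g y.-1) ->
  (y.+1 < n -> f y.+1 = g y.+1) -> checked n f y -> checked n g y.
Proof.
move=> e e1 e2 [a b c d h]; split; rewrite -?e //.
  by move=> h'; rewrite -e2 //; apply: c.
by move=> h'; rewrite -e1 //; apply: d.
Qed.

(** When [n <= R.*2] every window sticks out of the path, so any solution of [P] passes; a longer
    path is bridged from endpoint to endpoint. *)
Lemma checked_sol n : 0 < n -> exists lab, forall v, v < n -> checked n lab v.
Proof.
move=> n0; case: (leqP n R.*2) => hn.
  have [lab [h1 [h2 h3]]] := solvP n0; exists lab => v hv; split; try lia.
  - by move=> *; apply: h1.
  - split=> [-> /h3[] //|h n1]; have [_] := h3 n1.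
    by case: symP => <- _; have ->: n.-1 = v by lia.
  - by move=> *; apply: h2.
  - by move=> v0; have := h2 v.-1; rewrite prednK //; apply.
have hg : M.*2 <= n.-1 by lia.
have [f [f0 fg fl fn fS]] := @bridge None None n.-1 I I hg.
exists f => v hv; split.
- by move=> *; apply: fn; lia.
- split=> [-> _|h _]; first by rewrite f0; exact: hub_start hubS.
  by have ->: v = n.-1 by [lia]; rewrite fg; exact: hub_start hubS.
- by move=> *; apply: fl; lia.
- by move=> v0; rewrite -{2}(prednK v0); apply: fl; lia.
- by move=> *; apply: fS => *; lia.
Qed.

(** * Mending a single hole *)

Section Mend.
Variables (n : nat) (lam : nat -> option (G * G)) (v : nat).
Hypotheses (vn : v < n) (lv : lam v = None) (acc : star_accepts R psi n lam).

Let olam p := odflt w (lam p).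

Lemma accP y : y < n -> has_hole R n lam y \/ checked n olam y.
Proof. by move=> hy; apply/star_checkP => //; [exact: (hub_swap hubS) | exact: acc]. Qed.

(* The left boundary of the rewritten region [lo, ..]: the start of the path,
   a hole at [lo - 1] (so nothing near it is checked), or a checked node [al]. *)
Definition left_bd al a lo := [/\ anchor_ok a, lo <= v <= lo + R.*2,
  (if a is Some s then al < lo /\ al + R < v else al = 0 /\ lo = 0) &
  [\/ lo = 0, (0 < lo /\ lam lo.-1 = None) |
    [/\ lo = al.+1, lam al = a, a <> None &
        forall u, al < u -> u <= al + R -> lam u <> None]]].

(** Mirror image of [left_bd]. *)
Definition right_bd ar a hi := [/\ anchor_ok a, v <= hi <= v + R.*2, hi < n,
  (if a is Some s then hi < ar < n /\ v + R < ar else ar = n.-1 /\ hi = n.-1) &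
  [\/ hi = n.-1, (hi.+1 < n /\ lam hi.+1 = None) |
    [/\ ar = hi.+1, lam ar = a, a <> None &
        forall u, u < ar -> ar <= u + R -> lam u <> None]]].

Lemma left_bd_ex : exists al a lo, left_bd al a lo.
Proof.
case: (leqP v R.*2) => hv.
  by exists 0, None, 0; split=> //; try lia; constructor 1.
case: (excluded_middle_informative (exists b, [/\ v - R.*2.+1 <= b, b < v & lam b = None])).
  (* The hole at [b] hides the junction, so the bridge may start from an arbitrary state of [S],
     here [w], at the far end of the range. *)
  case=> b [h1 h2 h3]; exists (v - R.*2.+1), (Some w), b.+1; split.
  - exact: hub_w hubS.
  - by lia.
  - by lia.
  - by constructor 2.
(* The whole window of [u] lies left of [v] and contains no hole, so [u] is checked and its state
   belongs to [S]. *)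
move=> no; pose u := v - R.+1.
have nob b : v - R.*2.+1 <= b -> b < v -> lam b <> None by move=> h1 h2 h3; apply: no; exists b.
have un : u < n by lia.
case: (accP un) => [[b [hb h1 h2 h3]]|[_ _ _ _ h]].
  by case: (nob b) => //; rewrite /u in h1 h2; lia.
case e: (lam u) => [s|]; last by case: (nob u) => //; rewrite /u; lia.
exists u, (Some s), u.+1; split.
- by move: h; rewrite /olam e; apply; rewrite /u; lia.
- by rewrite /u; lia.
- by rewrite /u; lia.
- by constructor 3; split=> // b; rewrite /u => hb hb'; apply: nob; lia.
Qed.

Lemma right_bd_ex : exists ar a hi, right_bd ar a hi.
Proof.
case: (leqP n.-1 (v + R.*2)) => hv.
  by exists n.-1, None, n.-1; split=> //; try lia; constructor 1.
case: (excluded_middle_informative (exists b, [/\ v < b, b <= v + R.*2.+1 & lam b = None])).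
  case=> b [h1 h2 h3]; exists (v + R.*2.+1), (Some w), b.-1; split.
  - exact: hub_w hubS.
  - by lia.
  - by lia.
  - by lia.
  - by constructor 2; rewrite prednK; [split=> //; lia | lia].
move=> no; pose u := v + R.+1.
have nob b : v < b -> b <= v + R.*2.+1 -> lam b <> None by move=> h1 h2 h3; apply: no; exists b.
have un : u < n by rewrite /u; lia.
case: (accP un) => [[b [hb h1 h2 h3]]|[_ _ _ _ h]].
  by case: (nob b) => //; rewrite /u in h1 h2; lia.
case e: (lam u) => [s|]; last by case: (nob u) => //; rewrite /u; lia.
exists u, (Some s), u.-1; split.
- by move: h; rewrite /olam e; apply; rewrite /u; lia.
- by rewrite /u; lia.
- by rewrite /u; lia.
- by rewrite /u; lia.
- by constructor 3; rewrite prednK; [split=> // b; rewrite /u => hb hb'; apply: nob; lia | rewrite /u; lia].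
Qed.

Lemma fill al a lo ar b hi : left_bd al a lo -> right_bd ar b hi -> exists F,
  [/\ (forall y, lo <= y <= hi -> checked n F y), (forall s, a = Some s -> F al = s) &
      (forall s, b = Some s -> F ar = s)].
Proof.
case=> oka lov hal _ [okb vhi hin har _].
(* Between two endpoints the path may be too short for a bridge, so a complete solution is used.
   Otherwise one boundary is an inner anchor, more than [R] away from the other. *)
case: (boolP (~~ isSome a && ~~ isSome b)) => [ab|ab].
  have [F hF] := checked_sol (leq_ltn_trans (leq0n v) vn).
  exists F; split; first by move=> y hy; apply: hF; lia.
  - by move=> s e; move: ab; rewrite e.
  - by move=> s e; move: ab; rewrite e andbF.
have hg : M.*2 <= ar - al by case: (a) (b) hal har ab => [?|] [?|] //= *; lia.
have [f [f0 fg fl fn fS]] := bridge oka okb hg.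
have alo : al <= lo by case: (a) hal => [s|]; lia.
have har' : hi <= ar < n by case: (b) har => [s|]; lia.
have a0 : a = None -> al = 0 /\ lo = 0 by move=> e; rewrite e in hal.
have a1 : a <> None -> al < lo by case: (a) hal => // ? [].
have b0 : b = None -> ar = n.-1 /\ hi = n.-1 by move=> e; rewrite e in har.
have b1 : b <> None -> hi < ar by case: (b) har => // ? [] /andP[].
have aS : 0 < lo -> al < lo by move=> l0; apply: a1 => /a0 []; lia.
have bS : hi.+1 < n -> hi < ar by move=> l0; apply: b1 => /b0 []; lia.
exists (fun y => f (y - al)); split; last 2 first.
- by move=> s e; rewrite subnn f0 e.
- by move=> s e; rewrite fg e.
move=> y /andP[hy hy']; split.
- by move=> h1 h2; apply: fn; lia.
- split=> [y0 _|yn n1].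
    have [e1 e2] : al = 0 /\ a = None.
      by case: (a) a1 => [s /(_ ltac:(done))|]; [lia | split; [lia|]].
    by rewrite y0 f0 e2; exact: hub_start hubS.
  have e2 : b = None by case: (b) b1 => [s /(_ ltac:(done))|] //; lia.
  have [e1 _] := b0 e2.
  by have ->: y = ar by [lia]; rewrite fg e2; exact: hub_start hubS.
- by move=> h; rewrite subSn; [apply: fl; lia | lia].
- move=> h; rewrite (_ : y - al = (y.-1 - al).+1); last by lia.
  by apply: fl; lia.
- move=> h1 h2; apply: fS; first by lia.
  + by move=> /a0; lia.
  + by move=> /b0; lia.
Qed.

(** A node that still sees a hole is accepted. Any other node inside the block is checked through
    [F], any other node outside was already checked under [lam], and the boundary conditions make
    the two labelings agree across the junctions. *)
Lemma mend_hole : exists mu, is_mend R psi R.*2 n lam mu v.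
Proof.
have [al [a [lo hl]]] := left_bd_ex; have [ar [b [hi hr]]] := right_bd_ex.
have [F [chkF Fa Fb]] := fill hl hr.
case: hl => oka lov hal bl; case: hr => okb vhi hin har br.
pose mu y := if lo <= y <= hi then Some (F y) else lam y.
have muI y : lo <= y <= hi -> mu y = Some (F y) by rewrite /mu => ->.
have muO y : ~~ (lo <= y <= hi) -> mu y = lam y by rewrite /mu => /negPf ->.
exists mu; split; last 3 first.
- by rewrite muI //; lia.
- by move=> u _; rewrite /mu; case: ifP.
- by move=> u _; rewrite /mu /dist; case: ifP => // h _; lia.
move=> y hy; apply/(star_checkP symP _ _ _ w) => //; first exact: (hub_swap hubS).
case: (excluded_middle_informative (has_hole R n mu y)) => [|nh]; [by left | right].
have nhu u : u < n -> u <= y + R -> y <= u + R -> mu u <> None.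
  by move=> h1 h2 h3 h4; apply: nh; exists u.
(* Outside the block [mu] keeps the holes of [lam], so if no hole near [y] was filled, [y] was
   checked before. *)
have chkL : (forall u, lo <= u <= hi -> lam u = None -> u <= y + R -> y <= u + R -> False) ->
    checked n olam y.
  move=> hno; case: (accP hy) => // -[u [hu h1 h2 h3]].
  case: (boolP (lo <= u <= hi)) => h; first by case: (hno u).
  by case: (nhu u) => //; rewrite muO.
have inF u : lo <= u <= hi -> odflt w (mu u) = F u by move=> h; rewrite muI.
have outF u : ~~ (lo <= u <= hi) -> odflt w (mu u) = olam u by move=> h; rewrite muO.
(* When [lo.-1] is visible from [y] it cannot be a hole, so it is the checked node [al], where [F]
   starts. *)
have atal : 0 < lo -> lo.-1 <= y + R -> y <= lo.-1 + R -> odflt w (mu lo.-1) = F lo.-1.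
  move=> l0 h1 h2; case: bl => [|[_ e]|[e1 e2 e3 _]]; first lia.
  - by case: (nhu lo.-1) => //; [lia | rewrite muO //; lia].
  - rewrite muO; last lia.
    rewrite e1 /= e2; case: (a) e3 Fa => // s _ /(_ _ erefl) -> //.
have atar : hi.+1 < n -> hi.+1 <= y + R -> y <= hi.+1 + R -> odflt w (mu hi.+1) = F hi.+1.
  move=> l0 h1 h2; case: br => [|[_ e]|[e1 e2 e3 _]]; first lia.
  - by case: (nhu hi.+1) => //; rewrite muO //; lia.
  - rewrite muO; last lia.
    rewrite -e1 e2; case: (b) e3 Fb => // s _ /(_ _ erefl) -> //.
case: (boolP (lo <= y <= hi)) => yI.
  apply: checked_ext (chkF y yI); first by rewrite inF.
  - move=> y0; case: (leqP lo y.-1) => h; first by rewrite inF //; lia.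
    by have e: y = lo by [lia]; rewrite e atal //; lia.
  - move=> y0; case: (leqP y.+1 hi) => h; first by rewrite inF //; lia.
    by have e: y = hi by [lia]; rewrite e atar //; lia.
case: (ltnP y lo) => ylo.
  have cy : checked n olam y.
    apply: chkL => u hu lu h1 h2; case: bl => [|[l0 e]|[e1 e2 e3 e4]]; first lia.
    - by case: (nhu lo.-1); rewrite ?muO //; lia.
    - by case: (e4 u) => //; lia.
  case: (ltnP y.+1 lo) => ylo'.
    by apply: checked_ext cy => *; rewrite outF //; lia.
  have ey : y = lo.-1 by lia.
  case: cy => c1 c2 c3 c4 c5; rewrite -(outF y) // in c1 c2 c4 c5.
  split=> //.
  - move=> h; have [_ _ _ c _] := chkF lo ltac:(lia).
    rewrite {1}ey atal; try lia.
    by have e': y.+1 = lo by [lia]; rewrite e' inF; [apply: c; lia | lia].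
  - by move=> h; rewrite (outF y.-1); [apply: c4 | lia].
have yhi : hi < y by lia.
have cy : checked n olam y.
  apply: chkL => u hu lu h1 h2; case: br => [|[l0 e]|[e1 e2 e3 e4]]; first lia.
  - by case: (nhu hi.+1); rewrite ?muO //; lia.
  - by case: (e4 u) => //; lia.
case: (ltnP hi y.-1) => yhi'.
  by apply: checked_ext cy => *; rewrite outF //; lia.
have ey : y = hi.+1 by lia.
case: cy => c1 c2 c3 c4 c5; rewrite -(outF y) // in c1 c2 c3 c5.
split=> //.
- by move=> h; rewrite (outF y.+1); [apply: c3 | lia].
- move=> h; have [_ _ c _ _] := chkF hi ltac:(lia).
  rewrite {2}ey atar; try lia.
  by have e': y.-1 = hi by [lia]; rewrite e' inF; [apply: c; lia | lia].
Qed.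
End Mend.

Lemma restr_mendable : O1_mendable (restr P S R).
Proof.
exists R, psi; split=> //; first exact: restr_sym.
exists R.*2 => n lam n0 acc v hv; case e: (lam v) => [s|]; last exact: mend_hole.
by exists lam; split=> //; rewrite e.
Qed.
End Bridges.

(** * Local rules and the orientation towards peaks *)

(** Positions range over all integers: places beyond the ends read as [None], and shifts and
    reflections become the total isometries [iso]. *)
Definition cfg (n : nat) (ids : nat -> nat) (z : Z) : option nat :=
  if ((0 <=? z) && (z <? Z.of_nat n))%Z then Some (ids (Z.to_nat z)) else None.

Definition iso (b : bool) (e z : Z) : Z := (if b then e - z else e + z)%Z.

Lemma iso_inv b e z : iso b (if b then e else - e)%Z (iso b e z) = z.
Proof. by case: b; rewrite /iso; lia. Qed.

Lemma iso_inv' b e z : iso b e (iso b (if b then e else - e)%Z z) = z.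
Proof. by case: b; rewrite /iso; lia. Qed.

Definition within (T : nat) (z y : Z) : Prop := (Z.abs (y - z) <= Z.of_nat T)%Z.

(* Locality and invariance under reflection in one statement. *)
Definition local_rule (G : Type) c n T (label : (Z -> option nat) -> Z -> G * G) : Prop :=
  forall b e ids ids' z, valid_ids c n ids -> valid_ids c n ids' -> cfg n ids z <> None ->
    (forall y, within T z y -> cfg n ids y = cfg n ids' (iso b e y)) ->
    label (cfg n ids) z = orient b (label (cfg n ids') (iso b e z)).

Lemma cfg_win n T ids p y : p < n -> within T (Z.of_nat p) y ->
  cfg n ids y = nth None (win n T p ids) (Z.to_nat (y - Z.of_nat p + Z.of_nat T)%Z).
Proof.
rewrite /within => hp hy; rewrite nth_win; last lia.
rewrite /cfg; case: ifP => h1; case: ifP => h2 //; try lia.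
by congr (Some (ids _)); lia.
Qed.

Lemma cfg_nat n ids p : p < n -> cfg n ids (Z.of_nat p) = Some (ids p).
Proof. by move=> hp; rewrite /cfg Nat2Z.id; case: ifP => //; lia. Qed.

Lemma cfg_range n ids z : cfg n ids z <> None -> (0 <= z < Z.of_nat n)%Z.
Proof. by rewrite /cfg; case: ifP => // h _; lia. Qed.

Lemma cfg_inj c n ids y z a : valid_ids c n ids -> cfg n ids y = Some a -> cfg n ids z = Some a -> y = z.
Proof.
case=> inj _; rewrite /cfg; case: ifP => // hy [<-]; case: ifP => // hz [e].
by have := inj _ _ _ _ e; lia.
Qed.

Lemma valid_ids_rev c n ids : valid_ids c n ids -> valid_ids c n (fun p => ids (n.-1 - p)).
Proof.
case=> h1 h2; split=> [p q hp hq|p hp]; last by apply: h2; lia.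
by move/h1 => e; have := e ltac:(lia) ltac:(lia); lia.
Qed.

(** On a window the algorithm returns the label of any configuration showing it; invariance under
    shifts makes this independent of the choice. *)
Lemma local_rule_alg (G : Type) c n T (label : (Z -> option nat) -> Z -> G * G) :
  local_rule c n T label -> exists A : seq (option nat) -> G * G,
  forall ids b p, valid_ids c n ids -> p < n ->
    orient b (A (orientw b (win n T p ids))) = label (cfg n ids) (Z.of_nat p).
Proof.
move=> loc.
pose is_src w (x : (nat -> nat) * nat) := [/\ valid_ids c n x.1, x.2 < n & win n T x.2 x.1 = w].
have src w : exists r : G * G, forall x, is_src w x ->
    r = label (cfg n x.1) (Z.of_nat x.2).
  case: (excluded_middle_informative (exists x, is_src w x)) => [[x [vx nx hx]]|no]; last first.
    by exists (label (fun=> None) 0%Z) => x hx; case: no; exists x.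
  exists (label (cfg n x.1) (Z.of_nat x.2)) => y [vy ny hy].
  rewrite (loc false (Z.of_nat y.2 - Z.of_nat x.2)%Z _ y.1) //.
  - by congr (label _ _); rewrite /iso; lia.
  - by rewrite cfg_nat.
  - move=> z hz; rewrite (cfg_win x.1 nx hz) (@cfg_win n T y.1 y.2); [|exact: ny|].
      by rewrite hx hy; congr nth; rewrite /iso; lia.
    by move: hz; rewrite /within /iso; lia.
exists (fun w => proj1_sig (constructive_indefinite_description _ (src w))) => ids b p vi hp.
case: constructive_indefinite_description => r hr /=; case: b hr => hr /=; last by rewrite (hr (ids, p)).
have vr := valid_ids_rev vi.
(* A reversed window is the window of the mirrored node under the reversed identifiers. *)
rewrite (hr (fun q => ids (n.-1 - q), n.-1 - p)); last first.
  by split=> //=; [lia | rewrite -win_rev].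
rewrite /= (loc true (Z.of_nat n.-1)%Z ids (fun q => ids (n.-1 - q))) //=.
- by congr (swap (label _ _)); rewrite /iso; lia.
- by rewrite cfg_nat.
- move=> y _; rewrite /cfg /iso; case: ifP => h1; case: ifP => h2 //; try lia.
  by congr (Some (ids _)); lia.
Qed.

Lemma solvable_local (G : finType) c (Q : nat -> (nat -> G * G) -> Prop) T :
  (forall n f f', (forall p, p < n -> f p = f' p) -> Q n f -> Q n f') ->
  (forall n, 0 < n -> exists label, local_rule c n (T n) label /\
     forall ids, valid_ids c n ids -> Q n (fun p => label (cfg n ids) (Z.of_nat p))) ->
  solvable_in c Q T.
Proof.
move=> ext H.
have alg n : exists A : seq (option nat) -> G * G, 0 < n -> forall ids o, valid_ids c n ids ->
    Q n (fun p => orient (o p) (A (orientw (o p) (win n (T n) p ids)))).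
  case: (posnP n) => [->|n0].
    (* Length 0 demands only that some value exists, and the rule for length 1 provides one. *)
    case: (excluded_middle_informative (inhabited (G * G))) => [[x]|no]; first by exists (fun=> x).
    have [label _] := H 1 isT; by case: no; constructor; exact: (label (fun=> None) 0%Z).
  have [label [/local_rule_alg [A hA] hQ]] := H n n0.
  exists A => _ ids o vi; apply: ext (hQ _ vi) => p hp; by rewrite hA.
exists (fun n => proj1_sig (constructive_indefinite_description _ (alg n))) => n ids o n0 vi.
by rewrite /run; case: constructive_indefinite_description => A hA /=; apply: hA.
Qed.

(** * Peaks, directions and valleys of a key function *)

Section Peaks.
Variables (k l : nat).

Definition offset (s : bool) (z d : Z) : Z := (if s then z + d else z - d)%Z.
Definition side (s : bool) (d : nat) (z m : Z) : Prop :=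
  (if s then z < m <= z + Z.of_nat d else z - Z.of_nat d <= m < z)%Z.

Definition peak (K : Z -> nat) z : Prop :=
  0 < K z /\ forall y, within k z y -> y <> z -> K y < K z.

Definition dir K s z : Prop :=
  exists2 m, side s k z m & forall y, within k z y -> y <> m -> K y < K m.

Definition near_peak K s z : Prop := exists2 m, side s l z m & peak K m.

(** A peak within [l] overrides the side of the largest key, which keeps valleys away from peaks. *)
Definition toward K s z : Prop := near_peak K s z \/ (~ near_peak K (~~ s) z /\ dir K s z).

Definition valley K s z : Prop :=
  [/\ 0 < K z, 0 < K (offset s z 1), toward K (~~ s) z & toward K s (offset s z 1)].

(** A valley has two nodes, exchanged by a reflection; the larger identifier selects one of them. *)
Definition anchor (g : Z -> option nat) K z : Prop :=
  peak K z \/ exists2 s, valley K s z & odflt 0 (g (offset s z 1)) < odflt 0 (g z).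

Section Path.
Variables (n : nat) (K : Z -> nat) (g : Z -> option nat).
Hypotheses (l0 : 0 < l) (lk : l.*2 <= k).
Hypothesis Kpos : forall z, 0 < K z <-> (0 <= z < Z.of_nat n)%Z.
Hypothesis Kinj : forall z z', 0 < K z -> 0 < K z' -> within k.*2 z z' -> K z = K z' -> z = z'.
Hypothesis peak0 : peak K 0.
Hypothesis peakn : peak K (Z.of_nat n - 1)%Z.
Hypothesis ginj : forall z z', 0 < K z -> 0 < K z' ->
  odflt 0 (g z) = odflt 0 (g z') -> z = z'.

Lemma argmax (d : nat) z : exists2 m, within d z m & forall y, within d z y -> K y <= K m.
Proof.
rewrite /within; elim: d => [|d [m hm IH]].
  by exists z => [|y hy]; [lia | have ->: y = z by lia].
pose a := (z + Z.of_nat d.+1)%Z; pose b := (z - Z.of_nat d.+1)%Z.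
have cov y : (Z.abs (y - z) <= Z.of_nat d.+1)%Z -> y = a \/ y = b \/ (Z.abs (y - z) <= Z.of_nat d)%Z.
  by rewrite /a /b; lia.
have na : (Z.abs (a - z) <= Z.of_nat d.+1)%Z by rewrite /a; lia.
have nb : (Z.abs (b - z) <= Z.of_nat d.+1)%Z by rewrite /b; lia.
have nm : (Z.abs (m - z) <= Z.of_nat d.+1)%Z by lia.
clearbody a b.
have mx c : (Z.abs (c - z) <= Z.of_nat d.+1)%Z -> K a <= K c -> K b <= K c -> K m <= K c ->
    exists2 m', (Z.abs (m' - z) <= Z.of_nat d.+1)%Z &
      forall y, (Z.abs (y - z) <= Z.of_nat d.+1)%Z -> K y <= K m'.
  by move=> hc *; exists c => // y /cov[->|[->|/IH h]]; lia.
case: (leqP (K a) (K m)) => ha; case: (leqP (K b) (K m)) => hb; case: (leqP (K a) (K b)) => hc.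
all: by [apply: (mx m); lia | apply: (mx a); lia | apply: (mx b); lia].
Qed.

Lemma peak_dist z z' : peak K z -> peak K z' -> within k z z' -> z = z'.
Proof.
move=> [_ h] [_ h'] hz; case: (Z.eq_dec z z') => // ne.
by have := h z' hz ltac:(lia); have := h' z ltac:(rewrite /within in hz *; lia) ne; lia.
Qed.

Lemma dir_total z : 0 < K z -> ~ peak K z -> dir K true z \/ dir K false z.
Proof.
move=> z0 np; have [m hm mx] := argmax k z.
have Kzm : K z <= K m by apply: mx; rewrite /within; lia.
(* Two nodes of one window lie within [k.*2], where positive keys are distinct, so the maximum is
   strict. *)
have step y : within k z y -> y <> m -> K y < K m.
  move=> hy ne; have := mx y hy; rewrite leq_eqVlt => /orP[/eqP e|//].
  by case: ne; apply: (Kinj _ _ _ e); rewrite /within in hm hy *; lia.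
case: (Z.lt_total m z) => [lt|[e|lt]].
- by right; exists m => //; rewrite /side; rewrite /within in hm; lia.
- by case: np; split=> // y hy ne; rewrite -e; apply: step => //; rewrite e.
- by left; exists m => //; rewrite /side; rewrite /within in hm; lia.
Qed.

Lemma dir_excl s z : dir K s z -> dir K (~~ s) z -> False.
Proof.
case=> m hm h [m' hm' h'].
have ne : m <> m' by case: (s) hm hm'; rewrite /side /=; lia.
have := h m' ltac:(by case: (s) hm'; rewrite /side /within /=; lia) ltac:(by move=> e; apply: ne).
have := h' m ltac:(by case: (s) hm; rewrite /side /within /=; lia) ne.
by lia.
Qed.

Lemma peak_dir s z : peak K z -> dir K s z -> False.
Proof.
case=> z0 h [m hm h'].
have ne : m <> z by case: (s) hm; rewrite /side; lia.
have := h m ltac:(by case: (s) hm; rewrite /side /within /=; lia) ne.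
have := h' z ltac:(rewrite /within; lia) ltac:(by move=> e; apply: ne).
by lia.
Qed.

Lemma dir_any s z : 0 < K z -> ~ peak K z -> dir K s z \/ dir K (~~ s) z.
Proof. by move=> z0 np; case: s; case: (dir_total z0 np); auto. Qed.

(** Were the next node directed back, its maximum would lie in the window of [z] and have a smaller
    key than [m], while [m], lying in the window of the next node, would have the smaller key. *)
Lemma dir_step s z : dir K s z -> 0 < K (offset s z 1) -> ~ peak K (offset s z 1) -> dir K s (offset s z 1).
Proof.
move=> [m hm h] z0 np; case: (dir_any s z0 np) => // -[m' hm' h'].
have k0 : 0 < k by lia.
case: (Z.eq_dec m (offset s z 1)) => e.
  have := h' m ltac:(rewrite /within; lia) ltac:(by case: (s) hm' e; rewrite /side /offset /=; lia).
  have := h m' ltac:(by case: (s) hm' e; rewrite /side /offset /within /=; lia)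
               ltac:(by case: (s) hm' e; rewrite /side /offset /=; lia).
  by lia.
have := h' m ltac:(by case: (s) hm hm' e; rewrite /side /offset /within /=; lia)
             ltac:(by case: (s) hm hm' e; rewrite /side /offset /=; lia).
have := h m' ltac:(by case: (s) hm' e; rewrite /side /offset /within /=; lia)
             ltac:(by case: (s) hm hm' e; rewrite /side /offset /=; lia).
by lia.
Qed.

Lemma near_excl s z : near_peak K s z -> near_peak K (~~ s) z -> False.
Proof.
case=> m hm pm [m' hm' pm'].
have e : m = m'.
  by apply: peak_dist => //; case: (s) hm hm'; rewrite /side /within /=; lia.
by case: (s) hm hm'; rewrite /side e /=; lia.
Qed.

Lemma to_excl s z : toward K s z -> toward K (~~ s) z -> False.
Proof.
case=> [h|[h1 h2]] [h'|[h1' h2']] //.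
- exact: near_excl h h'.
- by rewrite negbK in h1'.
- exact: dir_excl h2 h2'.
Qed.

Lemma to_any s z : 0 < K z -> ~ peak K z -> toward K s z \/ toward K (~~ s) z.
Proof.
move=> z0 np; rewrite /toward negbK.
case: (excluded_middle_informative (near_peak K s z)) => h; first by left; left.
case: (excluded_middle_informative (near_peak K (~~ s) z)) => h'; first by right; left.
by case: (dir_any s z0 np) => hd; [left | right]; right.
Qed.

Lemma to_step s z : toward K s z -> ~ peak K z -> 0 < K (offset s z 1) -> ~ peak K (offset s z 1) ->
  toward K s (offset s z 1).
Proof.
move=> h npz z0 np; case: h => [[m hm pm]|[h1 h2]].
  left; exists m => //; case: (Z.eq_dec m (offset s z 1)) => e; first by rewrite -e in np.
  by case: (s) hm e; rewrite /side /offset; lia.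
right; split; last exact: dir_step.
case=> m hm pm; case: (Z.eq_dec m z) => e; first by rewrite -e in npz.
by apply: h1; exists m => //; case: (s) hm e; rewrite /side /offset /=; lia.
Qed.

Lemma to_near_peak s z m : toward K s z -> side (~~ s) l z m -> peak K m -> False.
Proof. by move=> h hm pm; apply: (to_excl h); left; exists m. Qed.

Lemma anchor_pos z : anchor g K z -> 0 < K z.
Proof. by case=> [[]|[s [] ]]. Qed.

(** One of the two valley nodes points away from [m] although [m] is a peak within [l] of it. *)
Lemma valley_peak s z m : valley K s z -> peak K m -> within l.-1 z m -> z = m.
Proof.
case=> z0 z1 t1 t2 pm; rewrite /within => hz; case: (Z.eq_dec z m) => // ne.
case: (Z.lt_total z m) => [lt|[//|lt]]; exfalso.
- case: (s) t1 t2; rewrite /offset /= => t1 t2.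
  + by apply: (to_near_peak t1 (m := m)) => //; rewrite /side /=; lia.
  + by apply: (to_near_peak t2 (m := m)) => //; rewrite /side /=; lia.
- case: (s) t1 t2; rewrite /offset /= => t1 t2.
  + by apply: (to_near_peak t2 (m := m)) => //; rewrite /side /=; lia.
  + by apply: (to_near_peak t1 (m := m)) => //; rewrite /side /=; lia.
Qed.

Lemma valley_edge s z : valley K s z -> exists v,
  [/\ (v <= z <= v + 1)%Z, toward K false v, toward K true (v + 1)%Z, 0 < K v /\ 0 < K (v + 1)%Z &
      z = if s then v else (v + 1)%Z].
Proof.
case: s => -[h1 h2 h3 h4]; rewrite /offset /= in h2 h3 h4.
- by exists z; split=> //; lia.
- by exists (z - 1)%Z; split; rewrite ?Z.sub_add //; lia.
Qed.

Lemma to_run z (j : nat) : toward K true z -> ~ peak K z ->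
  (forall i : nat, i <= j -> 0 < K (z + Z.of_nat i)%Z /\ ~ peak K (z + Z.of_nat i)%Z) ->
  toward K true (z + Z.of_nat j)%Z.
Proof.
move=> h np; elim: j => [|j IH] hj; first by rewrite Z.add_0_r.
have e : (z + Z.of_nat j.+1)%Z = offset true (z + Z.of_nat j)%Z 1 by rewrite /offset; lia.
have [a b] := hj j.+1 (leqnn _); have [a' b'] := hj j (leqnSn _).
by rewrite e; apply: to_step; rewrite -?e //; apply: IH => i hi; apply: hj; lia.
Qed.

Lemma to_nonpeak s z : toward K s z -> peak K z -> False.
Proof.
case=> [[m hm pm]|[_ h]] pz; last exact: peak_dir h.
have e : z = m by apply: peak_dist => //; case: (s) hm; rewrite /side /within; lia.
by case: (s) hm; rewrite /side; lia.
Qed.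

(** Peaks exclude each other within [k], and [valley_peak] separates peaks from valleys. Between two
    valleys the direction must turn at a peak, which would lie within [l] of the left node of the
    first valley, yet that node points left. *)
Lemma anchor_dist z z' : anchor g K z -> anchor g K z' -> (z < z')%Z ->
  (z + Z.of_nat l <= z')%Z.
Proof.
move=> az az' lt; case: (Z_lt_ge_dec z' (z + Z.of_nat l)) => [hz|]; last lia.
exfalso; case: az az' => [pz|[s vz iz]] [pz'|[s' vz' iz']].
- by have := peak_dist pz pz' ltac:(rewrite /within; lia); lia.
- by have := valley_peak vz' pz ltac:(rewrite /within; lia); lia.
- by have := valley_peak vz pz' ltac:(rewrite /within; lia); lia.
have [v [hv t1 t2 [p1 p2] ev]] := valley_edge vz; have [v' [hv' t1' t2' [p1' p2'] ev']] := valley_edge vz'.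
case: (Z.eq_dec v v') => e.
  (* Both anchors come from the same valley, where the comparison of identifiers admits only one. *)
  subst v'; case: s s' ev ev' iz iz' {vz vz'} => [] [] ev ev'; subst z z'; rewrite /offset; try lia.
  by rewrite Z.add_simpl_r; lia.
have np : ~ peak K (v + 1)%Z by move/(to_nonpeak t2).
have lt' : (v + 1 < v')%Z.
  case: (Z.eq_dec (v + 1) v') => e'; last lia.
  by rewrite -e' in t1'; case: (to_excl t2 t1').
pose j := Z.to_nat (v' - (v + 1)); have ej : v' = (v + 1 + Z.of_nat j)%Z by rewrite /j; lia.
case: (excluded_middle_informative (exists2 q : Z, (v + 1 < q < v')%Z & peak K q)) => [[p hp pp]|no].
  case: (to_excl (s := false) t1); left; exists p => //; rewrite /side /=; lia.
apply: (to_excl (s := true) (z := v') _ t1'); rewrite ej; apply: to_run => // i hi; split.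
- by apply/Kpos; move/Kpos in p1; move/Kpos in p1'; lia.
- move=> pi; case: (Z.eq_dec (v + 1 + Z.of_nat i) v') => e'.
    by rewrite e' in pi; case: (to_nonpeak t1' pi).
  case: (posnP i) => i0; first by rewrite i0 Z.add_0_r in pi.
  by apply: no; exists (v + 1 + Z.of_nat i)%Z => //; lia.
Qed.

(** A leftward node followed by a rightward one forms a valley, and one of the two would be an
    anchor. *)
Lemma gap_step z : 0 < K z -> 0 < K (z + 1)%Z -> ~ anchor g K z -> ~ anchor g K (z + 1)%Z ->
  toward K true z <-> toward K true (z + 1)%Z.
Proof.
move=> p1 p2 a1 a2.
have np1 : ~ peak K z by move=> h; apply: a1; left.
have np2 : ~ peak K (z + 1)%Z by move=> h; apply: a2; left.
split=> [h|h]; first exact: (to_step h np1 p2 np2).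
case: (to_any true p1 np1) => // h'; exfalso.
have ne : odflt 0 (g z) <> odflt 0 (g (z + 1)%Z) by move/ginj => /(_ p1 p2); lia.
case: (ltnP (odflt 0 (g (z + 1)%Z)) (odflt 0 (g z))) => hlt.
  by apply: a1; right; exists true.
have e : offset false (z + 1) 1 = z by rewrite /offset; lia.
by apply: a2; right; exists false; rewrite ?e; [split; rewrite ?e | lia].
Qed.

Lemma gap_const m (j : nat) : (forall i : nat, 0 < i <= j -> 0 < K (m + Z.of_nat i)%Z /\
    ~ anchor g K (m + Z.of_nat i)%Z) ->
  forall i i', 0 < i <= j -> 0 < i' <= j ->
  toward K true (m + Z.of_nat i)%Z -> toward K true (m + Z.of_nat i')%Z.
Proof.
move=> h.
have step i : 0 < i -> i < j -> toward K true (m + Z.of_nat i)%Z <-> toward K true (m + Z.of_nat i.+1)%Z.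
  move=> i0 ij; have [a b] := h i ltac:(lia); have [a' b'] := h i.+1 ltac:(lia).
  have e : (m + Z.of_nat i.+1)%Z = (m + Z.of_nat i + 1)%Z by lia.
  by rewrite e in a' b' *; exact: gap_step.
have one i : 0 < i <= j -> toward K true (m + Z.of_nat i)%Z <-> toward K true (m + Z.of_nat 1)%Z.
  elim: i => // i IH hi; case: (posnP i) => [->//|i0].
  by rewrite -step //; apply: IH; lia.
by move=> i i' hi hi' h1; apply/(one _ hi'); apply/(one _ hi).
Qed.

Variable Kmax : nat.
Hypothesis Kbnd : forall z, K z < Kmax.

(** Jumping to the largest key in sight raises the key, spans at most [k] and, short of a peak,
    keeps the direction; [j] bounds the number of jumps. *)
Lemma dir_peak (j : nat) s z : dir K s z -> Kmax <= K z + j ->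
  exists2 m, side s (k * j) z m & peak K m.
Proof.
elim: j z => [|j IH] z; first by have := Kbnd z; lia.
case=> y hy h hj.
have zy : K z < K y.
  by apply: h; [rewrite /within; lia | case: (s) hy; rewrite /side; lia].
case: (excluded_middle_informative (peak K y)) => py.
  by exists y => //; case: (s) hy; rewrite /side; nia.
case: (@dir_any s y ltac:(lia) py) => [dy|[y' hy' h']].
  have [m hm pm] := IH y dy ltac:(lia); exists m => //.
  by case: (s) hm hy; rewrite /side mulnS; lia.
exfalso.
have ne : y' <> y by case: (s) hy'; rewrite /side /=; lia.
have := h' y ltac:(rewrite /within; lia) ltac:(by move=> e; apply: ne).
have := h y' ltac:(by case: (s) hy hy'; rewrite /side /within /=; lia) ne.
lia.
Qed.

Lemma to_peak s z : toward K s z -> exists2 m, side s (k * Kmax) z m & peak K m.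
Proof.
case=> [[m hm pm]|[_ h]]; last by apply: dir_peak => //; lia.
have km : 0 < Kmax by have := Kbnd z; lia.
exists m => //; have h : l <= k * Kmax by nia.
by case: (s) hm; rewrite /side; lia.
Qed.
End Path.
End Peaks.

(** * Filling the gaps between anchors *)

Section Transport.
Variables (k l : nat).

Definition agree (A : Type) b e r z (f f' : Z -> A) : Prop :=
  forall y, within r z y -> f y = f' (iso b e y).

Definition inv_shift (b : bool) (e : Z) : Z := (if b then e else - e)%Z.

Lemma agree_inv (A : Type) b e r z (f f' : Z -> A) : agree b e r z f f' ->
  agree b (inv_shift b e) r (iso b e z) f' f.
Proof.
move=> h y hy; rewrite -{1}(iso_inv' b e y); symmetry; apply: h.
by move: hy; rewrite /within /iso /inv_shift; case: (b); lia.
Qed.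

Lemma agree_sub (A : Type) b e r r' z z' (f f' : Z -> A) : agree b e r z f f' ->
  within (r - r') z z' -> r' <= r -> agree b e r' z' f f'.
Proof. by move=> h hz hr y hy; apply: h; move: hz hy; rewrite /within; lia. Qed.

Lemma agree_le (A : Type) b e r r' z (f f' : Z -> A) : agree b e r z f f' ->
  r' <= r -> agree b e r' z f f'.
Proof. by move=> h hr y hy; apply: h; move: hy; rewrite /within; lia. Qed.

Lemma side_iso b e s d z m : side s d z m -> side (s (+) b) d (iso b e z) (iso b e m).
Proof. by rewrite /side /iso; case: s; case: b => /=; lia. Qed.

Lemma offset_iso b e s z d : iso b e (offset s z d) = offset (s (+) b) (iso b e z) d.
Proof. by rewrite /offset /iso; case: s; case: b => /=; lia. Qed.

Lemma within0 r z : within r z z.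
Proof. by rewrite /within; lia. Qed.

Arguments within0 : clear implicits.

Lemma within_iso_inv b e r z y : within r (iso b e z) y -> exists2 x, within r z x & y = iso b e x.
Proof.
move=> h; exists (iso b (inv_shift b e) y); last by rewrite iso_inv'.
by move: h; rewrite /within /iso /inv_shift; case: b; lia.
Qed.

Lemma peak_fwd b e z K K' : agree b e k z K K' -> peak k K z -> peak k K' (iso b e z).
Proof.
move=> h [z0 pk]; split; first by rewrite -h //; exact: within0.
move=> y /within_iso_inv[x hx ->] ne; rewrite -!h //; last exact: within0.
by apply: pk => // e'; apply: ne; rewrite e'.
Qed.

Lemma dir_fwd b e s z K K' : agree b e k z K K' -> dir k K s z -> dir k K' (s (+) b) (iso b e z).
Proof.
move=> h [m hm mx]; exists (iso b e m); first exact: side_iso.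
have nm : within k z m by move: hm; rewrite /within /side; case: s; lia.
move=> y /within_iso_inv[x hx ->] ne; rewrite -!h //.
by apply: mx => // e'; apply: ne; rewrite e'.
Qed.

Lemma near_fwd b e s z K K' : agree b e (l + k) z K K' ->
  near_peak k l K s z -> near_peak k l K' (s (+) b) (iso b e z).
Proof.
move=> h [m hm pm]; exists (iso b e m); first exact: side_iso.
apply: peak_fwd pm; apply: (agree_sub h); last lia.
by move: hm; rewrite /within /side; case: s; lia.
Qed.

(** The negation inside [toward] requires the converse transport, obtained from the inverse
    isometry. *)
Lemma near_bwd b e s z K K' : agree b e (l + k) z K K' ->
  near_peak k l K' (s (+) b) (iso b e z) -> near_peak k l K s z.
Proof. by move=> /agree_inv h /(near_fwd h); rewrite iso_inv addbK. Qed.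

Lemma to_fwd b e s z K K' : agree b e (l + k) z K K' ->
  toward k l K s z -> toward k l K' (s (+) b) (iso b e z).
Proof.
move=> h [/(near_fwd h)|[h1 h2]]; [by left | right; split].
  by rewrite -addNb => /(near_bwd h).
by apply: dir_fwd h2; apply: (agree_le h); lia.
Qed.

Lemma valley_fwd b e s z K K' : agree b e (l + k).+1 z K K' ->
  valley k l K s z -> valley k l K' (s (+) b) (iso b e z).
Proof.
move=> h [h1 h2 h3 h4].
have n1 : within 1 z (offset s z 1) by rewrite /within /offset; case: (s); lia.
have n1' : within (l + k).+1 z (offset s z 1) by move: n1; rewrite /within; lia.
rewrite /valley -offset_iso -addNb -!h //; last exact: within0.
split=> //.
- by apply: to_fwd h3; apply: (agree_le h); lia.
- apply: to_fwd h4; apply: (agree_sub h); last lia.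
  by move: n1; rewrite /within; lia.
Qed.

Lemma anchor_fwd b e z g g' K K' : agree b e (l + k).+1 z K K' -> agree b e 1 z g g' ->
  anchor k l g K z -> anchor k l g' K' (iso b e z).
Proof.
move=> h hg [pz|[s vz lt]].
  by left; apply: peak_fwd pz; apply: (agree_le h); lia.
right; exists (s (+) b); first exact: valley_fwd vz.
rewrite -offset_iso -!hg //; first exact: within0.
by rewrite /within /offset; case: (s); lia.
Qed.
End Transport.

(** * Labels assembled from anchors and fillings *)

Section Labels.
Variables (G : finType) (P : nec G) (w : G * G) (S : pred (G * G)) (M : nat) (x0 : G).
Hypotheses (symP : nec_symmetric P) (hubS : hub P w S M x0).
Variables (k l H rho Kmax : nat) (key : (Z -> option nat) -> Z -> nat).
Variable Phi : option (nat * option (G * G)) -> option (nat * option (G * G)) -> G * G.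

Definition idn (g : Z -> option nat) z : nat := odflt 0 (g z).
Definition isend (g : Z -> option nat) z : bool := ~~ (isSome (g (z - 1)%Z) && isSome (g (z + 1)%Z)).
(** Comparing the neighbouring identifiers to choose between [w] and its mirror image makes the
    state turn along with the path under a reflection. *)
Definition anchor_state g z : option (G * G) :=
  if isend g z then None else Some (if idn g (z - 1)%Z < idn g (z + 1)%Z then w else swap w).
Definition is_anchor g z : bool := asbool (anchor k l g (key g) z).
Definition oswap (r : bool) (a : option (G * G)) := omap (orient r) a.
Definition look g r s z : option (nat * option (G * G)) :=
  ohead [seq (j, oswap r (anchor_state g (offset s z (Z.of_nat j)))) | j <- iota 1 H & is_anchor g (offset s z (Z.of_nat j))].
(** A node between anchors turns the path so that its direction points ahead; [Phi] receives the
    anchor behind, then the anchor ahead. *)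
Definition label g z : G * G :=
  if is_anchor g z then anchor_val x0 (anchor_state g z)
  else let r := ~~ asbool (toward k l (key g) true z) in
       orient r (Phi (look g r r z) (look g r (~~ r) z)).

Variables (c n : nat).
Hypothesis key_local : forall b e ids ids' z, valid_ids c n ids -> valid_ids c n ids' ->
  agree b e rho z (cfg n ids) (cfg n ids') -> key (cfg n ids) z = key (cfg n ids') (iso b e z).

Hypotheses (l0 : 0 < l) (lk : l.*2 <= k) (n1 : 1 < n).
Hypothesis key_pos : forall ids z, valid_ids c n ids ->
  0 < key (cfg n ids) z <-> (0 <= z < Z.of_nat n)%Z.
Hypothesis key_inj : forall ids z z', valid_ids c n ids -> 0 < key (cfg n ids) z ->
  0 < key (cfg n ids) z' -> within k.*2 z z' -> key (cfg n ids) z = key (cfg n ids) z' -> z = z'.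
Hypothesis key_peak0 : forall ids, valid_ids c n ids -> peak k (key (cfg n ids)) 0.
Hypothesis key_peakn : forall ids, valid_ids c n ids -> peak k (key (cfg n ids)) (Z.of_nat n - 1)%Z.
Hypothesis key_bnd : forall ids z, valid_ids c n ids -> key (cfg n ids) z < Kmax.

Lemma asbool_iff Q Q' : (Q <-> Q') -> asbool Q = asbool Q'.
Proof. by case=> h h'; apply/asboolP/asboolP. Qed.

Lemma oswap_oswap r b a : oswap r (oswap b a) = oswap (r (+) b) a.
Proof. by case: a => // -[x y]; case: r; case: b. Qed.

Section Local.
Variables (b : bool) (e : Z) (ids ids' : nat -> nat).
Hypotheses (vi : valid_ids c n ids) (vi' : valid_ids c n ids').
Let g := cfg n ids.
Let g' := cfg n ids'.

Lemma key_agree r z : agree b e (r + rho) z g g' -> agree b e r z (key g) (key g').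
Proof.
move=> h y hy; apply: key_local => //; apply: (agree_sub h); last lia.
by rewrite addnK.
Qed.

Lemma anchor_state_local z : agree b e 1 z g g' -> anchor_state g z = oswap b (anchor_state g' (iso b e z)).
Proof.
move=> h; have := h (z - 1)%Z ltac:(rewrite /within; lia); have := h (z + 1)%Z ltac:(rewrite /within; lia).
rewrite /anchor_state /isend /idn; case: b {h}; rewrite /iso.
  have -> : (e - (z + 1) = e - z - 1)%Z by lia.
  have -> : (e - (z - 1) = e - z + 1)%Z by lia.
  move=> h1 h2; rewrite -h1 -h2 andbC; case: ifP => //= /negbFE /andP[].
  case e1: (g (z + 1)%Z) => [a1|] // _; case e2: (g (z - 1)%Z) => [a2|] //= _.
  case: (ltngtP a2 a1) => hlt; rewrite ?swapK //; subst a2.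
  by have := cfg_inj vi e1 e2; lia.
have -> : (e + (z + 1) = e + z + 1)%Z by lia.
have -> : (e + (z - 1) = e + z - 1)%Z by lia.
by move=> h1 h2; rewrite -h1 -h2; case: ifP.
Qed.

Lemma is_anchor_local z : agree b e ((l + k).+1 + rho) z g g' -> is_anchor g z = is_anchor g' (iso b e z).
Proof.
move=> h; have h1 : agree b e (l + k).+1 z (key g) (key g') by exact: key_agree.
have h2 : agree b e 1 z g g' by apply: (agree_le h); lia.
apply: asbool_iff; split; first exact: anchor_fwd.
by move/(anchor_fwd (agree_inv h1) (agree_inv h2)); rewrite iso_inv.
Qed.

Lemma look_local r s z : agree b e (H + ((l + k).+1 + rho)) z g g' ->
  look g r s z = look g' (r (+) b) (s (+) b) (iso b e z).
Proof.
move=> h; rewrite /look.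
have loc j : j \in iota 1 H -> agree b e ((l + k).+1 + rho) (offset s z (Z.of_nat j)) g g'.
  rewrite mem_iota => hj; apply: (agree_sub h); last lia.
  by rewrite /within /offset; case: (s); lia.
have ->: [seq j <- iota 1 H | is_anchor g (offset s z (Z.of_nat j))] =
         [seq j <- iota 1 H | is_anchor g' (offset (s (+) b) (iso b e z) (Z.of_nat j))].
  by apply: eq_in_filter => j /loc hj; rewrite -offset_iso is_anchor_local.
congr ohead; apply/eq_in_map => j; rewrite mem_filter => /andP[_ /loc hj].
congr pair; rewrite -offset_iso -oswap_oswap -anchor_state_local //.
by apply: (agree_le hj); lia.
Qed.

Lemma label_local z : g z <> None -> agree b e (H + ((l + k).+1 + rho)) z g g' ->
  label g z = orient b (label g' (iso b e z)).
Proof.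
move=> hz h; rewrite /label -is_anchor_local; last by apply: (agree_le h); lia.
case: ifP => na.
  rewrite (@anchor_state_local z); last by apply: (agree_le h); lia.
  by rewrite /anchor_val; case: (anchor_state g' _) => //=; case: (b).
have ht : agree b e (l + k) z (key g) (key g').
  by apply: key_agree; apply: (agree_le h); lia.
set r := ~~ asbool (toward k l (key g) true z).
(* Exactly one direction holds at a node that is not a peak, so a reflection negates the test for
   the rightward one. *)
have -> : ~~ asbool (toward k l (key g') true (iso b e z)) = r (+) b.
  have pz : 0 < key g z by apply/(key_pos _ vi); exact: cfg_range hz.
  have npz : ~ peak k (key g) z by move=> pk; move/negP: na; apply; apply/asboolP; left.
  have tf s : toward k l (key g) s z -> toward k l (key g') (s (+) b) (iso b e z) by exact: to_fwd.
  have excl := to_excl l0 lk (K := key g').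
  case: (to_any l0 lk (fun y y' => @key_inj _ y y' vi) true pz npz) => h1.
  - have -> : r = false by apply/negbF/asboolP.
    have := tf _ h1; case: (b) => /= h2; last by apply/negbF/asboolP.
    by apply/negP => /asboolP h3; apply: (excl true (iso true e z)).
  - have -> : r = true.
      by apply/negP => /asboolP h3; apply: (to_excl l0 lk h3 h1).
    have := tf _ h1; case: (b) => /= h2; first by apply/negbF/asboolP.
    by apply/negP => /asboolP h3; apply: (excl true (iso false e z)).
rewrite (look_local r r h) (look_local r (~~ r) h) addNb.
by case: (r); case: (b); rewrite /= ?swapK.
Qed.
End Local.

Lemma label_rule : local_rule c n (H + ((l + k).+1 + rho)) label.
Proof. by move=> b e ids ids' z vi vi' hz h; apply: label_local. Qed.

Definition see j (t : option (G * G)) : option (nat * option (G * G)) :=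
  if j <= H then Some (j, t) else None.

Definition filling t h gl j : G * G :=
  if j == 0 then anchor_val x0 t else if j == gl then anchor_val x0 h
  else Phi (see j t) (see (gl - j) h).

Definition good_filling (t h : option (G * G)) gl (f : nat -> G * G) : Prop :=
  [/\ (forall i, i < gl -> link P (f i) (f i.+1)), (forall i, 0 < i < gl -> nodeok P (f i)) &
      (forall i, i <= gl -> (t = None -> M <= i) -> (h = None -> i + M <= gl) -> S (f i))].

Hypothesis PhiP : forall t h gl, anchor_ok S t -> anchor_ok S h -> l <= gl -> gl <= (k * Kmax).+1 ->
  good_filling t h gl (filling t h gl).

Section Correct.
Variable ids : nat -> nat.
Hypothesis vi : valid_ids c n ids.
Let g := cfg n ids.
Let K := key g.

Lemma anchor_val_oswap r a : anchor_val x0 (oswap r a) = orient r (anchor_val x0 a).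
Proof. by case: a => //; case: r. Qed.

Lemma idn_inj z z' : 0 < K z -> 0 < K z' -> idn g z = idn g z' -> z = z'.
Proof.
move=> /(key_pos _ vi) h /(key_pos _ vi) h'; rewrite /idn /g /cfg.
case: ifP => [_|]; last lia; case: ifP => [_|]; last lia; move=> /= e.
by case: vi => inj _; have := inj _ _ _ _ e; lia.
Qed.

Lemma isend_cfg z : (0 <= z < Z.of_nat n)%Z -> isend g z -> (z = 0 \/ z = Z.of_nat n - 1)%Z.
Proof.
move=> hz; rewrite /isend /g /cfg.
by case: ifP => h1; case: ifP => h2 //= _; lia.
Qed.

Lemma end_isend z : (z = 0 \/ z = Z.of_nat n - 1)%Z -> isend g z.
Proof.
move=> hz; rewrite /isend /g /cfg.
by case: ifP => h1; case: ifP => h2 //=; lia.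
Qed.

Lemma anchor_state_ok z : anchor_ok S (anchor_state g z).
Proof.
rewrite /anchor_state; case: ifP => //= _; case: ifP => _; first exact: hub_w hubS.
by apply: (hub_swap hubS); exact: hub_w hubS.
Qed.

Lemma oswap_ok r a : anchor_ok S a -> anchor_ok S (oswap r a).
Proof. by case: a => //= s hs; case: r => //=; exact: (hub_swap hubS). Qed.

Lemma look_eval r s z j : 0 < j -> is_anchor g (offset s z (Z.of_nat j)) ->
  (forall i, 0 < i < j -> ~~ is_anchor g (offset s z (Z.of_nat i))) ->
  look g r s z = see j (oswap r (anchor_state g (offset s z (Z.of_nat j)))).
Proof.
move=> j0 aj no; rewrite /look /see.
pose p i := is_anchor g (offset s z (Z.of_nat i)).
have no' a b : 0 < a -> a + b <= j -> [seq i <- iota a b | p i] = [::].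
  move=> a0 hab; apply/eqP; rewrite -[_ == _]negbK -has_filter; apply/hasPn => i.
  by rewrite mem_iota => hi; apply: no; lia.
case: leqP => hj; last by rewrite (no' 1 H) //; lia.
have -> : H = j.-1 + (H - j).+1 by lia.
rewrite iotaD filter_cat (no' 1 j.-1) //; last lia.
by rewrite (_ : 1 + j.-1 = j) //=; [rewrite aj | lia].
Qed.

(** Directions agree along a gap. A rightward gap is a filling from its left to its right anchor; a
    leftward one is the mirror image of a filling between the mirrored anchors. *)
Lemma gap_fill m gl : 0 < gl -> is_anchor g m -> is_anchor g (m + Z.of_nat gl) ->
  (forall i, 0 < i < gl -> ~~ is_anchor g (m + Z.of_nat i)) ->
  exists f, (forall i, i <= gl -> label g (m + Z.of_nat i) = f i) /\
    good_filling (anchor_state g m) (anchor_state g (m + Z.of_nat gl)) gl f.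
Proof.
move=> gl0 am am' no.
have Kp : forall z, 0 < K z <-> (0 <= z < Z.of_nat n)%Z := fun z => key_pos z vi.
have Ki : forall z z', 0 < K z -> 0 < K z' -> within k.*2 z z' -> K z = K z' -> z = z' :=
  fun z z' => @key_inj ids z z' vi.
have Kb z : K z < Kmax := key_bnd z vi.
have Am : anchor k l g K m by apply/asboolP.
have Am' : anchor k l g K (m + Z.of_nat gl) by apply/asboolP.
have rm : (0 <= m < Z.of_nat n)%Z by apply/Kp/(anchor_pos Am).
have rm' : (0 <= m + Z.of_nat gl < Z.of_nat n)%Z by apply/Kp/(anchor_pos Am').
have hl : l <= gl by have := anchor_dist l0 lk Kp Ki Am Am' ltac:(lia); lia.
have nA i : 0 < i <= gl.-1 -> 0 < K (m + Z.of_nat i)%Z /\ ~ anchor k l g K (m + Z.of_nat i)%Z.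
  move=> hi; split; first by apply/Kp; lia.
  by move/asboolP; apply/negP/no; lia.
have nP i : 0 < i <= gl.-1 -> ~ peak k K (m + Z.of_nat i)%Z.
  by move=> /nA [_ h] pk; apply: h; left.
have const := gap_const l0 lk Ki idn_inj nA.
have all_dir : exists s, forall i, 0 < i < gl -> toward k l K s (m + Z.of_nat i).
  case: (ltnP 1 gl) => h1; last by exists true => i; lia.
  have i1 : 0 < 1 <= gl.-1 by lia.
  have [p1 _] := nA 1 i1.
  case: (to_any l0 lk Ki true p1 (nP 1 i1)) => h.
    by exists true => i hi; apply: (const 1 i) => //; lia.
  exists false => i hi; have hi' : 0 < i <= gl.-1 by lia.
  have [p2 _] := nA i hi'; case: (to_any l0 lk Ki true p2 (nP i hi')) => // h'.
  by case: (to_excl l0 lk (const i 1 hi' i1 h') h).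
have far m1 : (m < m1 < m + Z.of_nat gl)%Z -> ~ peak k K m1.
  move=> hm pk; apply: (nP (Z.to_nat (m1 - m))); first lia.
  by rewrite (_ : m + _ = m1)%Z //; lia.
(* The peak that the rearmost inner node points to is an anchor and so cannot lie inside the gap;
   its distance bounds the length. *)
have hK : gl <= (k * Kmax).+1.
  case: all_dir => -[] hs; case: (ltnP 1 gl) => h1; try lia.
  - have [m1 hm pm] := to_peak l0 lk Ki Kb (hs 1 ltac:(lia)).
    case: (Z_lt_ge_dec m1 (m + Z.of_nat gl)) => h2; last by rewrite /side in hm; lia.
    by case: (far m1 _ pm); rewrite /side in hm; lia.
  - have [m1 hm pm] := to_peak l0 lk Ki Kb (hs gl.-1 ltac:(lia)).
    case: (Z_lt_ge_dec m m1) => h2; last by rewrite /side in hm; lia.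
    by case: (far m1 _ pm); rewrite /side in hm; lia.
have Labm : label g m = anchor_val x0 (anchor_state g m) by rewrite /label am.
have Labm' : label g (m + Z.of_nat gl) = anchor_val x0 (anchor_state g (m + Z.of_nat gl)) by rewrite /label am'.
have lookL r i : 0 < i < gl -> look g r false (m + Z.of_nat i) = see i (oswap r (anchor_state g m)).
  move=> hi; have e : offset false (m + Z.of_nat i) (Z.of_nat i) = m by rewrite /offset; lia.
  rewrite -{2}e; apply: look_eval; [lia | by rewrite e |] => i' hi'.
  by rewrite (_ : offset _ _ _ = m + Z.of_nat (i - i'))%Z; [apply: no; lia | rewrite /offset; lia].
have lookR r i : 0 < i < gl ->
    look g r true (m + Z.of_nat i) = see (gl - i) (oswap r (anchor_state g (m + Z.of_nat gl))).
  move=> hi; have e : offset true (m + Z.of_nat i) (Z.of_nat (gl - i)) = (m + Z.of_nat gl)%Z by rewrite /offset; lia.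
  rewrite -{1}e; apply: look_eval; [lia | by rewrite e |] => i' hi'.
  by rewrite (_ : offset _ _ _ = m + Z.of_nat (i + i'))%Z; [apply: no; lia | rewrite /offset; lia].
have os a : oswap false a = a by case: a.
case: all_dir => -[] hs.
- exists (filling (anchor_state g m) (anchor_state g (m + Z.of_nat gl)) gl); split; last first.
    by apply: PhiP => //; exact: anchor_state_ok.
  move=> i hi; rewrite /filling; case: eqP => [->|i0]; first by rewrite Z.add_0_r.
  case: eqP => [->//|i1].
  rewrite /label ifN; last by apply: no; lia.
  rewrite (_ : asbool _ = true) /=; last by apply/asboolP/hs; lia.
  by rewrite lookL ?lookR ?os //; lia.
- have [f1 f2 f3] := PhiP (oswap_ok true (anchor_state_ok (m + Z.of_nat gl))) (oswap_ok true (anchor_state_ok m)) hl hK.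
  set f0 := filling _ _ _ in f1 f2 f3.
  exists (fun i => swap (f0 (gl - i))); split; last split.
  + move=> i hi; rewrite /f0 /filling; have -> : (gl - i == 0) = (i == gl) by lia.
    have -> : (gl - i == gl) = (i == 0) by lia.
    case: eqP => [->|i1]; first by rewrite anchor_val_oswap swapK.
    case: eqP => [->|i0]; first by rewrite anchor_val_oswap swapK Z.add_0_r.
    rewrite /label ifN; last by apply: no; lia.
    rewrite (_ : asbool _ = false) /=; last first.
      by apply/negP => /asboolP h; apply: (to_excl l0 lk h); apply: hs; lia.
    by rewrite lookL ?lookR ?subKn //; lia.
  + move=> i hi; rewrite link_swap // (_ : gl - i = (gl - i.+1).+1); last lia.
    by apply: f1; lia.
  + by move=> i hi; rewrite nodeok_swap //; apply: f2; lia.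
  + move=> i hi h1 h2; apply: (hub_swap hubS); apply: f3; first lia.
    * by case: (anchor_state _ _) h2 => //= /(_ erefl); lia.
    * by case: (anchor_state _ _) h1 => //= /(_ erefl); lia.
Qed.

(** The ends are peaks, hence anchors, so anchors exist on both sides of every edge. *)
Lemma gap_at v : v.+1 < n -> exists p gl, [/\ p <= v < p + gl, p + gl < n,
  is_anchor g (Z.of_nat p), is_anchor g (Z.of_nat p + Z.of_nat gl) &
  forall i, 0 < i < gl -> ~~ is_anchor g (Z.of_nat p + Z.of_nat i)].
Proof.
move=> hv.
have a0 : is_anchor g (Z.of_nat 0) by apply/asboolP; left; exact: key_peak0.
have an : is_anchor g (Z.of_nat n.-1).
  by apply/asboolP; left; rewrite (_ : Z.of_nat _ = Z.of_nat n - 1)%Z; [exact: key_peakn | lia].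
have ex1 : exists i, (i <= v) && is_anchor g (Z.of_nat i) by exists 0.
have ex2 : exists i, (v < i) && is_anchor g (Z.of_nat i) by exists n.-1; rewrite an andbT; lia.
case: (ex_maxnP ex1 (m := v)) => [i /andP[] //|p /andP[pv ap] pmax].
case: (ex_minnP ex2) => q /andP[vq aq] qmin.
exists p, (q - p); split=> //; try lia.
- by have := qmin n.-1; rewrite an andbT; lia.
- by rewrite (_ : _ + _ = Z.of_nat q)%Z //; lia.
- move=> i hi; apply/negP; rewrite (_ : _ + _ = Z.of_nat (p + i))%Z; last lia.
  move=> ai; case: (leqP (p + i) v) => h.
    by have := pmax (p + i); rewrite h ai; lia.
  by have := qmin (p + i); rewrite h ai; lia.
Qed.

Lemma label_link v : v.+1 < n -> link P (label g (Z.of_nat v)) (label g (Z.of_nat v.+1)).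
Proof.
move=> hv; have [p [gl [hp hq a1 a2 no]]] := gap_at hv.
have gl0 : 0 < gl by lia.
have [f [hf [fl _ _]]] := gap_fill gl0 a1 a2 no.
have := fl (v - p) ltac:(lia); rewrite -!hf; try lia.
have -> : (Z.of_nat p + Z.of_nat (v - p) = Z.of_nat v)%Z by lia.
by have -> : (Z.of_nat p + Z.of_nat (v - p).+1 = Z.of_nat v.+1)%Z by lia.
Qed.

Lemma label_checked R v : 0 < R -> M <= R -> v < n -> checked P S R n (fun p => label g (Z.of_nat p)) v.
Proof.
move=> R0 MR hv.
have endv : (v = 0 \/ v = n.-1) -> label g (Z.of_nat v) = (x0, x0).
  move=> e; have av : is_anchor g (Z.of_nat v).
    apply/asboolP; left; case: e => ->; first exact: key_peak0.
    by rewrite (_ : Z.of_nat _ = Z.of_nat n - 1)%Z; [exact: key_peakn | lia].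
  by rewrite /label av /anchor_state end_isend //; lia.
have inner : 0 < v -> v.+1 < n -> nodeok P (label g (Z.of_nat v)) /\
    (R <= v -> v + R < n -> S (label g (Z.of_nat v))).
  move=> v0 v1; have [p [gl [hp hq a1 a2 no]]] := gap_at v1.
  have gl0 : 0 < gl by lia.
  have [f [hf [_ fn fS]]] := gap_fill gl0 a1 a2 no.
  have ev : label g (Z.of_nat v) = f (v - p).
    by rewrite -hf; [congr (label g _); lia | lia].
  case: (eqVneq v p) => [evp|nvp].
    have : S (label g (Z.of_nat v)).
      have /negPf ne : ~~ isend g (Z.of_nat v) by apply/negP => /isend_cfg; lia.
      have := anchor_state_ok (Z.of_nat v); rewrite /label evp a1 -evp.
      by rewrite /anchor_state ne.
    by move=> hS; split=> //; apply: (hub_node hubS).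
  split; first by rewrite ev; apply: fn; lia.
  move=> h1 h2; rewrite ev; apply: fS; first lia.
  - rewrite /anchor_state; case: ifP => // /isend_cfg; lia.
  - rewrite /anchor_state; case: ifP => // /isend_cfg; lia.
split.
- by move=> h1 h2; have [] := inner h1 h2.
- by split=> [e _|e _]; rewrite endv; try lia; exact: hub_start hubS.
- exact: label_link.
- by move=> v0; have := @label_link v.-1; rewrite prednK //; apply.
- by move=> h1 h2; have [_] := inner ltac:(lia) ltac:(lia); apply.
Qed.
End Correct.
End Labels.

(** * Symmetry-breaking keys *)

Lemma local_rule_mono (G : Type) c n T T' (L : (Z -> option nat) -> Z -> G * G) : T <= T' ->
  local_rule c n T L -> local_rule c n T' L.
Proof.
move=> h lr b e ids ids' z vi vi' hz ag; apply: lr => // y hy; apply: ag.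
by move: hy; rewrite /within; lia.
Qed.

Section Keys.
Variables (k D BIG rho0 c n : nat) (inner : (Z -> option nat) -> Z -> nat).

(** Distance to the nearer end, capped at [D]. *)
Definition end_dist (g : Z -> option nat) z : nat :=
  find (fun i => ~~ isSome (g (z - Z.of_nat i.+1)%Z) || ~~ isSome (g (z + Z.of_nat i.+1)%Z)) (iota 0 D).

(* Keys increase towards the ends, which thereby become peaks. *)
Definition key (g : Z -> option nat) z : nat :=
  if g z is None then 0
  else if end_dist g z < D then BIG + (D - end_dist g z) else (inner g z).+1.

Definition interior (z : Z) : Prop := (Z.of_nat D <= z < Z.of_nat n - Z.of_nat D)%Z.

Hypotheses (D0 : 0 < D) (Dn : D.*2 + k.*2 < n).
Hypothesis inner_local : forall b e ids ids' z, valid_ids c n ids -> valid_ids c n ids' ->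
  interior z -> interior (iso b e z) ->
  agree b e rho0 z (cfg n ids) (cfg n ids') -> inner (cfg n ids) z = inner (cfg n ids') (iso b e z).
Hypothesis inner_inj : forall ids z z', valid_ids c n ids -> interior z -> interior z' ->
  within k.*2 z z' -> inner (cfg n ids) z = inner (cfg n ids) z' -> z = z'.
Hypothesis inner_bnd : forall ids z, valid_ids c n ids -> interior z -> inner (cfg n ids) z < BIG.

Lemma end_dist_cfg ids z : (0 <= z < Z.of_nat n)%Z ->
  end_dist (cfg n ids) z = minn D (minn (Z.to_nat z) (Z.to_nat (Z.of_nat n - 1 - z))).
Proof.
move=> hz; rewrite /end_dist; set p := (X in find X).
have pE i : p i = (Z.to_nat z <= i) || (Z.to_nat (Z.of_nat n - 1 - z) <= i).
  by rewrite /p /cfg; case: ifP => h1; case: ifP => h2 /=; lia.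
set m := minn (Z.to_nat z) _.
have pm i : p i = (m <= i) by rewrite pE /m; lia.
case: (leqP D m) => h.
- apply/eqP; rewrite eqn_leq {1}(leq_trans (find_size _ _)) ?size_iota //=.
  rewrite leqNgt; apply/negP => hlt.
  have /(nth_find 0) : has p (iota 0 D) by rewrite has_find size_iota.
  rewrite nth_iota // pm; move: hlt; lia.
- have hs : has p (iota 0 D) by apply/hasP; exists m; rewrite ?mem_iota ?pm //; lia.
  have := nth_find 0 hs; have lt : find p (iota 0 D) < D by rewrite -[X in _ < X](size_iota 0) -has_find.
  rewrite nth_iota // add0n pm => h1.
  apply/eqP; rewrite eqn_leq h1 andbT leqNgt; apply/negP => h2.
  by have := before_find 0 h2; rewrite nth_iota // add0n pm leqnn.
Qed.

Lemma key_out ids z : ~ (0 <= z < Z.of_nat n)%Z -> key (cfg n ids) z = 0.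
Proof. by rewrite /key /cfg; case: ifP => // h1 h; lia. Qed.

Lemma key_in ids z : (0 <= z < Z.of_nat n)%Z -> let e := minn (Z.to_nat z) (Z.to_nat (Z.of_nat n - 1 - z)) in
  key (cfg n ids) z = if e < D then BIG + (D - e) else (inner (cfg n ids) z).+1.
Proof.
move=> hz e; rewrite /key end_dist_cfg // -/e.
have -> : (minn D e < D) = (e < D) by lia.
case E: (cfg n ids z) => [a|]; last by move: E; rewrite /cfg; case: ifP => //; lia.
by case: ifP => // h; congr (_ + (_ - _)); lia.
Qed.

Lemma key_pos ids z : 0 < key (cfg n ids) z <-> (0 <= z < Z.of_nat n)%Z.
Proof.
split=> [h|h]; last by rewrite key_in //; case: ifP => // h'; lia.
case: (excluded_middle_informative (0 <= z < Z.of_nat n)%Z) => // no.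
by rewrite key_out in h.
Qed.

Lemma key_inj ids z z' : valid_ids c n ids -> 0 < key (cfg n ids) z ->
  0 < key (cfg n ids) z' -> within k.*2 z z' -> key (cfg n ids) z = key (cfg n ids) z' -> z = z'.
Proof.
move=> vi /key_pos h /key_pos h' hz; rewrite !key_in //.
case: ifP => e1; case: ifP => e2 e.
(* Equal keys mean equal distances to the nearer end; opposite ends are excluded by
   [D.*2 + k.*2 < n]. *)
- by rewrite /within in hz; lia.
- by have := @inner_bnd ids z' vi ltac:(rewrite /interior; lia); lia.
- by have := @inner_bnd ids z vi ltac:(rewrite /interior; lia); lia.
- by apply: (@inner_inj ids) => //; [rewrite /interior; lia | rewrite /interior; lia | case: e].
Qed.

Lemma key_lt ids z : valid_ids c n ids -> key (cfg n ids) z < BIG + D.+2.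
Proof.
move=> vi; case: (excluded_middle_informative (0 <= z < Z.of_nat n)%Z) => h; last by rewrite key_out //; lia.
rewrite key_in //; case: ifP => e; first lia.
by have := @inner_bnd ids z vi ltac:(rewrite /interior; lia); lia.
Qed.

Lemma key_peak_end ids z : valid_ids c n ids -> z = 0%Z \/ z = (Z.of_nat n - 1)%Z ->
  peak k (key (cfg n ids)) z.
Proof.
move=> vi hz; split; first by apply/key_pos; lia.
move=> y hy ne; rewrite (@key_in ids z); last lia.
rewrite ifT; last lia.
case: (excluded_middle_informative (0 <= y < Z.of_nat n)%Z) => h; last by rewrite key_out //; lia.
rewrite key_in //; case: ifP => e; first by rewrite /within in hy; lia.
by have := @inner_bnd ids y vi ltac:(rewrite /interior; lia); lia.
Qed.

Lemma key_local b e ids ids' z : valid_ids c n ids -> valid_ids c n ids' ->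
  agree b e (D + rho0) z (cfg n ids) (cfg n ids') -> key (cfg n ids) z = key (cfg n ids') (iso b e z).
Proof.
move=> vi vi' h.
have h0 : cfg n ids z = cfg n ids' (iso b e z) by apply: h; exact: within0.
have he : end_dist (cfg n ids) z = end_dist (cfg n ids') (iso b e z).
  rewrite /end_dist; apply: eq_in_find => i; rewrite mem_iota => hi.
  rewrite !h /within; try lia.
  rewrite orbC /iso; case: (b).
    by congr (~~ isSome (cfg _ _ _) || ~~ isSome (cfg _ _ _)); lia.
  by rewrite orbC; congr (~~ isSome (cfg _ _ _) || ~~ isSome (cfg _ _ _)); lia.
rewrite /key -h0 -he; case E: (cfg n ids z) => [a|] //.
case: ltnP => // hD; congr S; apply: inner_local => //; last 1 first.
- by apply: (agree_le h); lia.
- have r : (0 <= z < Z.of_nat n)%Z by apply: (@cfg_range _ ids); rewrite E.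
  by have := end_dist_cfg ids r; rewrite /interior; lia.
- have r : (0 <= iso b e z < Z.of_nat n)%Z by apply: (@cfg_range _ ids'); rewrite -h0 E.
  by have := end_dist_cfg ids' r; rewrite -he /interior; lia.
Qed.
End Keys.

(** * Rules for one path length *)

Section OneSize.
Variables (G : finType) (P : nec G) (w : G * G) (S : pred (G * G)) (M : nat) (x0 : G) (R c n : nat).
Hypotheses (symP : nec_symmetric P) (hubS : hub P w S M x0) (R0 : 0 < R) (MR : M <= R) (M0 : 0 < M).

Definition rule_for T := exists label, local_rule c n T label /\
  forall ids, valid_ids c n ids -> lcl_sol (restr P S R) n (fun p => label (cfg n ids) (Z.of_nat p)).

Lemma rule_for_mono T T' : T <= T' -> rule_for T -> rule_for T'.
Proof. by move=> h [L [h1 h2]]; exists L; split=> //; exact: local_rule_mono h1. Qed.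

(** With radius [n] every node sees the whole path, and the end with the smaller identifier serves
    as the start of [sol]. *)
Lemma rule_small sol : 0 < n -> lcl_sol (restr P S R) n sol -> rule_for n.
Proof.
move=> n0 hsol; pose an := (Z.of_nat n - 1)%Z.
exists (fun g z => if n == 1 then (x0, x0) else
  let p := Z.to_nat z in if idn g 0 < idn g an then sol p else swap (sol (n.-1 - p))); split.
- move=> b e ids ids' z [inj _] [inj' _] /cfg_range hz h; case: eqP => n1; first by case: (b).
  have i0 ids1 : cfg n ids1 0 = Some (ids1 0) by rewrite -(cfg_nat (n := n)).
  have in' ids1 : cfg n ids1 an = Some (ids1 n.-1).
    by rewrite -(cfg_nat (n := n)); [congr cfg; rewrite /an; lia | lia].
  have outside ids1 y : ~ (0 <= y < Z.of_nat n)%Z -> cfg n ids1 y = None.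
    by rewrite /cfg; case: ifP => // *; lia.
  (* The image of 0 is on the path and that of the empty position -1 is not, so the isometry maps
     the path onto itself. *)
  have h1 := h 0%Z ltac:(rewrite /within; lia); have h2 := h (-1)%Z ltac:(rewrite /within; lia).
  have h3 := h an ltac:(rewrite /within /an; lia).
  rewrite i0 in h1; rewrite in' in h3; rewrite outside in h2; last lia.
  have r1 : (0 <= iso b e 0 < Z.of_nat n)%Z by apply: (@cfg_range _ ids'); rewrite -h1.
  have r2 : ~ (0 <= iso b e (-1) < Z.of_nat n)%Z.
    by move: h2; rewrite /cfg; case: ifP => // h4 _; lia.
  have ne : ids 0 <> ids n.-1 by move/inj => /(_ ltac:(lia) ltac:(lia)); lia.
  rewrite /idn !i0 !in' /=.
  case: b h h1 h3 r1 r2 {h2}; rewrite /iso => h h1 h3 r1 r2 /=.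
    have ee : e = an by rewrite /an; lia.
    rewrite ee Z.sub_0_r in' in h1; rewrite ee Z.sub_diag i0 in h3; rewrite ee.
    case: h1 h3 => e1 [e2]; rewrite -e1 -e2.
    have -> : Z.to_nat (an - z) = n.-1 - Z.to_nat z by rewrite /an; lia.
    have -> : n.-1 - (n.-1 - Z.to_nat z) = Z.to_nat z by lia.
    by case: ltngtP => // _; rewrite swapK.
  have ee : e = 0%Z by lia.
  rewrite ee Z.add_0_l i0 in h1; rewrite ee Z.add_0_l in' in h3; rewrite ee Z.add_0_l.
  by case: h1 h3 => e1 [e2]; rewrite /= e1 e2.
- move=> ids vi; case: (eqVneq n 1) => n1.
    by apply/restr_solP => // [|v hv]; [exact: (hub_swap hubS) | split; try lia; split; lia].
  pose t := idn (cfg n ids) 0 < idn (cfg n ids) an.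
  apply: (@restr_sol_ext _ _ _ _ _ (fun p => if t then sol p else swap (sol (n.-1 - p)))).
    by move=> p hp; rewrite Nat2Z.id.
  case: t; first by apply: (@restr_sol_ext _ _ _ _ _ sol).
  apply/restr_solP => // [|v hv]; first exact: (hub_swap hubS).
  have [a [b1 b2] c1 d1 e1] :=
    iffLR (restr_solP symP (hub_swap hubS) R0 n sol) hsol (n.-1 - v) ltac:(lia).
  split.
  + by move=> *; rewrite nodeok_swap //; apply: a; lia.
  + by split=> [hv0 h|hv0 h] /=; [apply: b2; lia | apply: b1; lia].
  + move=> h; rewrite link_swap // (_ : n.-1 - v.+1 = (n.-1 - v).-1); last lia.
    by apply: d1; lia.
  + move=> h; rewrite link_swap // (_ : n.-1 - v.-1 = (n.-1 - v).+1); last lia.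
    by apply: c1; lia.
  + by move=> *; apply: (hub_swap hubS); apply: e1; lia.
Qed.

Variables (D BIG rho0 H : nat) (inner : (Z -> option nat) -> Z -> nat).
Variable Phi : option (nat * option (G * G)) -> option (nat * option (G * G)) -> G * G.
(** Anchors are at least [l] apart, the length that a bridge requires. *)
Let l := M.*2.
Let k := l.*2.

Lemma rule_large : 0 < D -> D.*2 + k.*2 < n ->
  (forall b e ids ids' z, valid_ids c n ids -> valid_ids c n ids' ->
    interior D n z -> interior D n (iso b e z) -> agree b e rho0 z (cfg n ids) (cfg n ids') ->
    inner (cfg n ids) z = inner (cfg n ids') (iso b e z)) ->
  (forall ids z z', valid_ids c n ids -> interior D n z -> interior D n z' ->
    within k.*2 z z' -> inner (cfg n ids) z = inner (cfg n ids) z' -> z = z') ->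
  (forall ids z, valid_ids c n ids -> interior D n z -> inner (cfg n ids) z < BIG) ->
  (forall t h gl, anchor_ok S t -> anchor_ok S h -> l <= gl -> gl <= (k * (BIG + D.+2)).+1 ->
    good_filling P S M t h gl (filling x0 H Phi t h gl)) ->
  rule_for (H + ((l + k).+1 + (D + rho0))).
Proof.
move=> D0 Dn loc inj bnd PhiP.
have l0 : 0 < l by rewrite /l; lia.
have n1 : 1 < n by lia.
have kl : forall b e ids ids' z, valid_ids c n ids -> valid_ids c n ids' ->
    agree b e (D + rho0) z (cfg n ids) (cfg n ids') ->
    key D BIG inner (cfg n ids) z = key D BIG inner (cfg n ids') (iso b e z).
  move=> b e ids ids' z vi vi' h; exact: (key_local BIG D0 Dn loc vi vi' h).
have kp : forall ids z, valid_ids c n ids ->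
    0 < key D BIG inner (cfg n ids) z <-> (0 <= z < Z.of_nat n)%Z.
  by move=> ids z _; apply: (key_pos BIG inner D0 Dn).
have ki : forall ids z z', valid_ids c n ids -> 0 < key D BIG inner (cfg n ids) z ->
    0 < key D BIG inner (cfg n ids) z' -> within k.*2 z z' ->
    key D BIG inner (cfg n ids) z = key D BIG inner (cfg n ids) z' -> z = z'.
  by move=> ids z z'; apply: (key_inj D0 Dn inj bnd).
have kb : forall ids z, valid_ids c n ids -> key D BIG inner (cfg n ids) z < BIG + D.+2.
  by move=> ids z; apply: (key_lt D0 Dn bnd).
have p0 : forall ids, valid_ids c n ids -> peak k (key D BIG inner (cfg n ids)) 0.
  by move=> ids vi; apply: (key_peak_end D0 Dn bnd) => //; left.
have pn : forall ids, valid_ids c n ids -> peak k (key D BIG inner (cfg n ids)) (Z.of_nat n - 1)%Z.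
  by move=> ids vi; apply: (key_peak_end D0 Dn bnd) => //; right.
exists (label w x0 k l H (key D BIG inner) Phi); split.
  exact: (@label_rule G w x0 k l H (D + rho0) (key D BIG inner) Phi c n kl l0 (leqnn _) n1 kp ki).
move=> ids vi; apply/restr_solP => // [|v hv]; first exact: (hub_swap hubS).
exact: (label_checked symP hubS l0 (leqnn _) n1 kp ki p0 pn kb PhiP vi R0 MR hv).
Qed.
End OneSize.

(** * Colours extracted from a fast algorithm *)

Section Algorithm.
Variables (G : finType) (P : nec G) (c n T : nat) (A : seq (option nat) -> G * G).
Hypotheses (symP : nec_symmetric P) (c0 : 0 < c).
Hypothesis algA : forall ids o, valid_ids c n ids ->
  nec_sol P n (fun p => orient (o p) (A (orientw (o p) (win n T p ids)))).

Definition id_list (s : nat) (u : seq nat) : Prop :=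
  [/\ uniq u, size u = s & {subset u <= iota 1 (n ^ c)}].

Lemma n_le : n <= n ^ c.
Proof. by case: (posnP n) => [->//|n0]; rewrite -[leqLHS]expn1 leq_pexp2l. Qed.

Definition fresh (u : seq nat) := [seq x <- iota 1 (n ^ c) | x \notin u].

Lemma size_fresh u : uniq u -> n ^ c <= size u + size (fresh u).
Proof.
move=> uu; rewrite -{1}(size_iota 1 (n ^ c)) -size_cat; apply: uniq_leq_size; first exact: iota_uniq.
by move=> x hx; rewrite mem_cat mem_filter hx andbT orbN.
Qed.

Lemma embed s u a : id_list s u -> a + s <= n ->
  exists2 ids, valid_ids c n ids & forall i, i < s -> ids (a + i) = nth 0 u i.
Proof.
case=> uu su sub hs.
have sf := size_fresh uu; have hn := n_le.
pose L := take a (fresh u) ++ u ++ drop a (fresh u).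
have hf : a <= size (fresh u) by rewrite su in sf; move: (leq_trans hn sf); lia.
have ta : size (take a (fresh u)) = a by rewrite size_takel.
have pL : perm_eq L (u ++ fresh u).
  by rewrite /L perm_catCA perm_cat2l cat_take_drop.
have uL : uniq L.
  rewrite (perm_uniq pL) cat_uniq uu filter_uniq ?iota_uniq // andbT.
  by apply/hasPn => x; rewrite mem_filter => /andP[].
have sL : n <= size L by rewrite (perm_size pL) size_cat; exact: leq_trans hn sf.
have rL x : x \in L -> 0 < x <= n ^ c.
  have hi : x \in L -> x \in iota 1 (n ^ c).
    by rewrite (perm_mem pL) mem_cat => /orP[/sub //|]; rewrite mem_filter => /andP[].
  by move/hi; rewrite mem_iota add1n ltnS.
exists (nth 0 L); first split.
- move=> p q hp hq e; apply/eqP.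
  by rewrite -(nth_uniq 0 (leq_trans hp sL) (leq_trans hq sL) uL) e.
- by move=> p hp; apply: rL; apply: mem_nth; exact: leq_trans sL.
- by move=> i hi; rewrite /L nth_cat ta ltnNge leq_addr /= addKn nth_cat su hi.
Qed.

Definition window_size := T.*2.+1.

Lemma win_list ids p u : T <= p -> p + T < n -> size u = window_size ->
  (forall i, i < window_size -> ids (p - T + i) = nth 0 u i) -> win n T p ids = map Some u.
Proof.
move=> h1 h2 su h; apply: (@eq_from_nth _ None); first by rewrite size_win size_map su.
move=> i; rewrite size_win => hi; rewrite nth_win // (nth_map 0) ?su // -h //.
by case: ifP; [move=> _; congr (Some (ids _)); lia | rewrite /window_size in hi; lia].
Qed.

Definition out (b : bool) (u : seq nat) : G * G := orient b (A (orientw b (map Some u))).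

Lemma out_rev b u : out b (rev u) = swap (out (~~ b) u).
Proof. by case: b; rewrite /out /= -map_rev ?revK ?swapK. Qed.

Lemma id_list_rev s u : id_list s u -> id_list s (rev u).
Proof.
case=> h1 h2 h3; split; rewrite ?rev_uniq ?size_rev // => x; rewrite mem_rev; exact: h3.
Qed.

Lemma two_windows u1 u2 m b1 b2 : id_list window_size u1 -> id_list window_size u2 -> ~~ has (mem u1) u2 ->
  window_size <= m -> m + window_size + 2 <= n -> exists lab, [/\ nec_sol P n lab, lab T.+1 = out b1 u1 &
    lab (T.+1 + m) = out b2 u2].
Proof.
move=> [uu1 su1 s1] [uu2 su2 s2] dis hm hn.
have uu12 : uniq (u1 ++ u2) by rewrite cat_uniq uu1 uu2 dis.
have sf := size_fresh uu12; have hnc := n_le; rewrite size_cat su1 su2 in sf.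
pose mid := take (m - window_size) (fresh (u1 ++ u2)).
have smid : size mid = m - window_size by rewrite size_takel //; lia.
have midP x : x \in mid -> (x \notin u1 ++ u2) /\ x \in iota 1 (n ^ c).
  by move/mem_take; rewrite mem_filter => /andP[].
pose u := u1 ++ mid ++ u2.
have lu : id_list (m + window_size) u.
  split.
  - rewrite /u (perm_uniq (s2 := mid ++ (u1 ++ u2))); last by rewrite perm_catCA.
    rewrite cat_uniq uu12 andbT take_uniq ?filter_uniq ?iota_uniq //=.
    by apply/hasPn => x hx; apply/negP => /midP[]; rewrite hx.
  - by rewrite !size_cat su1 su2 smid; lia.
  - by move=> x; rewrite !mem_cat => /or3P[/s1|/midP[]|/s2].
(* Starting the block at node 1 leaves both endpoints outside it, so the two centres are inner nodes
   with full windows. *)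
have [ids vi hids] := embed (a := 1) lu ltac:(lia).
pose o p := if p == T.+1 then b1 else b2.
exists (fun p => orient (o p) (A (orientw (o p) (win n T p ids)))); split; first exact: algA.
- rewrite /o eqxx (win_list (u := u1)) //; rewrite /window_size in hm hn *; try lia.
  move=> i hi; rewrite (_ : T.+1 - T + i = 1 + i); last lia.
  by rewrite hids ?/u ?nth_cat ?su1 /window_size ?hi //; lia.
- rewrite /o ifN; last by rewrite /window_size in hm; lia.
  rewrite (win_list (u := u2)) //; rewrite /window_size in hm hn *; try lia.
  move=> i hi; rewrite (_ : T.+1 + m - T + i = 1 + (m + i)); last lia.
  rewrite hids; last by rewrite /window_size; lia.
  rewrite /u catA nth_cat size_cat su1 smid /window_size ifN; last by lia.
  by congr nth; lia.
Qed.

Lemma sol_walk lab p m : nec_sol P n lab -> 0 < p -> p + m.+1 < n -> walk P m (lab p) (lab (p + m)).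
Proof.
move=> [h1 [h2 _]] p0 hp; exists (fun i => lab (p + i)); split; rewrite ?addn0 // => i hi.
rewrite addnS; apply/and3P; split; first by apply: h1; lia.
- by apply: h1; lia.
- by apply: h2; lia.
Qed.

Lemma out_flex u1 u2 m b1 b2 : id_list window_size u1 -> id_list window_size u2 -> ~~ has (mem u1) u2 ->
  window_size <= m -> m + window_size + 2 <= n -> walk P m (out b1 u1) (out b2 u2).
Proof.
move=> h1 h2 d hm hn; have [lab [hl <- <-]] := two_windows b1 b2 h1 h2 d hm hn.
by apply: sol_walk => //; rewrite /window_size in hn hm; lia.
Qed.

Hypothesis nT : 4 * T + 9 <= n.

Lemma other_window u : id_list window_size u -> exists u2, id_list window_size u2 /\ ~~ has (mem u) u2.
Proof.
case=> uu su _; have sf := size_fresh uu; have hnc := n_le.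
exists (take window_size (fresh u)); split; first split.
- by rewrite take_uniq // filter_uniq // iota_uniq.
- by rewrite size_takel //; move: (leq_trans hnc sf); rewrite su /window_size; move: (size (fresh u)) => K; clear -nT; lia.
- by move=> x /mem_take; rewrite mem_filter => /andP[].
- by apply/hasPn => x /mem_take; rewrite mem_filter => /andP[].
Qed.

Lemma disj_sym (u v : seq nat) : ~~ has (mem u) v -> ~~ has (mem v) u.
Proof. by rewrite has_sym. Qed.

Lemma disj_rev (u v : seq nat) : ~~ has (mem u) v -> ~~ has (mem (rev u)) v.
Proof. by move/hasPn => h; apply/hasPn => x /h; rewrite /= mem_rev. Qed.

(** Going to a disjoint window and back gives closed walks of two consecutive lengths; returning to
    the reversed window ends in the mirror image. *)
Lemma out_walks b u : id_list window_size u ->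
  [/\ walk P (window_size + window_size) (out b u) (out b u), walk P (window_size + window_size).+1 (out b u) (out b u) &
      walk P (window_size + window_size) (out b u) (swap (out b u))].
Proof.
move=> hu; have [v [hv d]] := other_window hu.
have w1 : window_size <= window_size /\ window_size + window_size + 2 <= n by rewrite /window_size; lia.
have w2 : window_size <= window_size.+1 /\ window_size.+1 + window_size + 2 <= n by rewrite /window_size; lia.
case: w1 w2 => a1 a2 [a3 a4].
split.
- by apply: walk_cat (out_flex b false hu hv d a1 a2) (out_flex _ _ hv hu (disj_sym d) a1 a2).
- rewrite -addnS; apply: walk_cat (out_flex b false hu hv d a1 a2) _.
  exact: out_flex _ _ hv hu (disj_sym d) a3 a4.
- have -> : swap (out b u) = out (~~ b) (rev u) by rewrite out_rev negbK.
  apply: walk_cat (out_flex b false hu hv d a1 a2) (out_flex _ _ hv (id_list_rev hu) _ a1 a2).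
  by apply: disj_sym; exact: disj_rev.
Qed.

Lemma out_good b u : id_list window_size u -> good P (out b u).
Proof.
move=> hu; have [h1 h2 h3] := out_walks b hu.
have [h1' h2' h3'] := out_walks (~~ b) (id_list_rev hu).
rewrite !out_rev negbK swapK in h1' h2' h3'.
have pos : 0 < window_size + window_size by [].
have [v [hv d]] := other_window hu.
have f1 := flexible_loop h1 h2 pos; have f2 := flexible_loop h1' h2' pos.
have hn : window_size + window_size + 2 <= n by rewrite /window_size; lia.
have [lab [hl e _]] := two_windows b false hu hv d (leqnn _) hn.
have [hnode [hedge hend]] := hl.
split => //.
- by rewrite -e; apply: hnode; lia.
- exact: flexible_cat h3 f2.
- exact: flexible_cat h3' f1.
(* The start label is the one that the algorithm itself writes at the endpoint in such a run. *)
- exists (lab 0).2, (lab 1); split.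
  + by have [] := hend ltac:(lia).
  + by apply: hedge; lia.
  + by apply: hnode; lia.
  + rewrite -e (_ : T.+1 = 1 + T) //; apply: walk_connect (sol_walk hl _ _) => //; lia.
Qed.

Definition slice (q : nat -> nat) a s := [seq q i | i <- iota a s].

Lemma slice_list q a s : {in iota a s &, injective q} -> {in iota a s, forall i, 0 < q i <= n ^ c} ->
  id_list s (slice q a s).
Proof.
move=> inj rng; split; first by rewrite map_inj_in_uniq ?iota_uniq.
- by rewrite size_map size_iota.
- by move=> x /mapP[i hi ->]; have := rng i hi; rewrite mem_iota; lia.
Qed.

Lemma nth_slice q a s i : i < s -> nth 0 (slice q a s) i = q (a + i).
Proof. by move=> hi; rewrite (nth_map 0) ?size_iota // nth_iota. Qed.

(** Windows shifted by one belong to adjacent nodes of one path, whose ports may be oriented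
    independently. *)
Lemma out_link q a b b' : {in iota a window_size.+1 &, injective q} ->
  {in iota a window_size.+1, forall i, 0 < q i <= n ^ c} ->
  link P (out b (slice q a window_size)) (out b' (slice q a.+1 window_size)).
Proof.
move=> inj rng; have lu := slice_list inj rng.
have [ids vi hids] := embed (a := 1) lu ltac:(rewrite /window_size; lia).
pose o p := if p == T.+1 then b else b'.
have [_ [h _]] := algA o vi; have := h T.+1 ltac:(lia); rewrite /o eqxx.
rewrite (_ : (T.+2 == T.+1) = false); last by lia.
rewrite (@win_list _ T.+1 (slice q a window_size)) ?(@win_list _ T.+2 (slice q a.+1 window_size)) //; try lia.
- by rewrite size_map size_iota.
- move=> i hi; rewrite (_ : T.+2 - T + i = 1 + i.+1) ?hids ?nth_slice //; try lia.
  by congr q; lia.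
- by rewrite size_map size_iota.
- move=> i hi; rewrite (_ : T.+1 - T + i = 1 + i) ?hids ?nth_slice //; lia.
Qed.

Definition flip (u : seq nat) := ~~ (head 0 u < last 0 u).
Definition canon (u : seq nat) := orientw (flip u) u.
(** Coloured lists carry one more identifier on each side than a window, so that both neighbours of
    the centre are visible even for [T = 0]. *)
Definition trim (u : seq nat) := take window_size (behead u).

(* The canonically oriented output, and the comparison of the central identifier
   with its two neighbours: the comparisons separate adjacent nodes whose canonical
   orientations face each other. *)
Definition colour (u : seq nat) : (G * G) * (bool * bool) :=
  let v := canon u in
  (A (map Some (trim v)), (nth 0 v T.+1 < nth 0 v T.+2, nth 0 v T.+1 < nth 0 v T)).

Lemma colour_rev u : uniq u -> 1 < size u -> colour (rev u) = colour u.
Proof.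
move=> uu su; rewrite /colour; suff -> : canon (rev u) = canon u by [].
case: u uu su => // x u; case/lastP: u => // u y.
rewrite /canon /flip rev_cons rev_rcons /= rcons_uniq mem_rcons inE negb_or !last_rcons.
by case/andP => /andP[xy _] _ _; case: ltngtP xy => // _ _; rewrite /orientw /= !(rev_cons, rev_rcons, revK).
Qed.

Lemma trim_rev u : size u = window_size.+2 -> trim (rev u) = rev (trim u).
Proof.
case: u => // x u; case/lastP: u => // u y; rewrite /= size_rcons => -[su].
rewrite /trim rev_cons rev_rcons /= -cats1 take_size_cat ?size_rev //.
by rewrite -cats1 take_size_cat.
Qed.

Lemma trim_slice q a : trim (slice q a window_size.+2) = slice q a.+1 window_size.
Proof.
rewrite /trim (_ : behead _ = [seq q i | i <- iota a.+1 window_size.+1]) // -map_take take_iota.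
by rewrite (minn_idPl (leqnSn _)).
Qed.

Lemma colour_out u : size u = window_size.+2 -> orient (flip u) (colour u).1 = out (flip u) (trim u).
Proof.
move=> su; rewrite /colour /canon /out /=; case: (flip u) => //=.
by rewrite trim_rev // map_rev.
Qed.

Hypothesis noloop : forall s, good P s -> ~~ link P s s.

(** Under equal orientations, equal colours would let a good state follow itself. Under opposite
    ones, equal bits would order the two central identifiers both ways. *)
Lemma colour_neq q : {in iota 0 window_size.+3 &, injective q} ->
  {in iota 0 window_size.+3, forall i, 0 < q i <= n ^ c} ->
  colour (slice q 0 window_size.+2) <> colour (slice q 1 window_size.+2).
Proof.
move=> inj rng.
have sub a s i : a + s <= window_size.+3 -> i \in iota a s -> i \in iota 0 window_size.+3.
  by rewrite !mem_iota; lia.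
have su a : size (slice q a window_size.+2) = window_size.+2 by rewrite size_map size_iota.
have lk : link P (out (flip (slice q 0 window_size.+2)) (slice q 1 window_size))
                 (out (flip (slice q 1 window_size.+2)) (slice q 2 window_size)).
  by apply: out_link => [i j hi hj|i hi]; [apply: inj | apply: rng]; apply: (sub 1 window_size.+1) => //; lia.
have gd b : good P (out b (slice q 1 window_size)).
  by apply: out_good; apply: slice_list => [i j hi hj|i hi]; [apply: inj | apply: rng]; apply: (sub 1 window_size) => //; lia.
move: lk (gd (flip (slice q 0 window_size.+2))).
rewrite -!trim_slice -!colour_out //.
have qq : q T.+1 <> q T.+2.
  by move=> e; have := inj T.+1 T.+2; rewrite !mem_iota => /(_ ltac:(rewrite /window_size; lia) ltac:(rewrite /window_size; lia) e); lia.
have n0 a i : i < window_size.+2 -> nth 0 (slice q a window_size.+2) i = q (a + i) by exact: nth_slice.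
have n1 a i : i < window_size.+2 -> nth 0 (rev (slice q a window_size.+2)) i = q (a + (window_size.+1 - i)).
  by move=> hi; rewrite nth_rev su // n0; [congr q; lia | lia].
have a1 : nth 0 (slice q 0 window_size.+2) T.+1 = q T.+1 by rewrite n0 //; rewrite /window_size; lia.
have a2 : nth 0 (slice q 0 window_size.+2) T.+2 = q T.+2 by rewrite n0 //; rewrite /window_size; lia.
have b1 : nth 0 (slice q 1 window_size.+2) T.+1 = q T.+2 by rewrite n0 //; rewrite /window_size; lia.
have b2 : nth 0 (slice q 1 window_size.+2) T = q T.+1 by rewrite n0 //; rewrite /window_size; lia.
have r1 : nth 0 (rev (slice q 0 window_size.+2)) T.+1 = q T.+1.
  by rewrite n1; [congr q; rewrite /window_size; lia | rewrite /window_size; lia].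
have r2 : nth 0 (rev (slice q 0 window_size.+2)) T = q T.+2.
  by rewrite n1; [congr q; rewrite /window_size; lia | rewrite /window_size; lia].
have s1 : nth 0 (rev (slice q 1 window_size.+2)) T.+1 = q T.+2.
  by rewrite n1; [congr q; rewrite /window_size; lia | rewrite /window_size; lia].
have s2 : nth 0 (rev (slice q 1 window_size.+2)) T.+2 = q T.+1.
  by rewrite n1; [congr q; rewrite /window_size; lia | rewrite /window_size; lia].
move=> lk g e; rewrite -e in lk.
case eb: (flip (slice q 0 window_size.+2)) lk g; case eb': (flip (slice q 1 window_size.+2)) => lk g.
- by have := noloop g; rewrite lk.
(* Orientations point apart: each centre is compared with its predecessor, which is the other
   centre. *)
- move: e; rewrite /colour /canon eb eb' /orientw r1 r2 b1 b2 => -[_ _].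
  by case: ltngtP qq.
(* Orientations face each other: the other centre is the successor. *)
- move: e; rewrite /colour /canon eb eb' /orientw a1 a2 s1 s2 => -[_ h _]; move: h.
  by case: ltngtP qq.
- by have := noloop g; rewrite lk.
Qed.
End Algorithm.

(** * Fillings and stride colours *)

Lemma choice_fun (X Y : Type) (Q : X -> Y -> Prop) :
  (forall x, exists y, Q x y) -> exists f, forall x, Q x (f x).
Proof.
move=> h; exists (fun x => proj1_sig (constructive_indefinite_description _ (h x))) => x.
by case: constructive_indefinite_description.
Qed.

Section Fillings.
Variables (G : finType) (P : nec G) (w : G * G) (S : pred (G * G)) (M : nat) (x0 : G).
Hypotheses (symP : nec_symmetric P) (hubS : hub P w S M x0) (M0 : 0 < M).

Lemma good_filling_ext t h gl F f : (forall i, i <= gl -> F i = f i) ->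
  good_filling P S M t h gl f -> good_filling P S M t h gl F.
Proof.
move=> e [h1 h2 h3]; split=> i hi.
- by rewrite !e //; [apply: h1 | lia].
- by rewrite e; [apply: h2 | lia].
- by move=> a b; rewrite e //; apply: h3.
Qed.

(** When [gl <= H] every inner node sees both anchors, recovers [gl] as the sum of its two
    distances, and reads its label off a bridge fixed in advance. *)
Lemma bridge_filling H : exists Phi, forall t h gl, anchor_ok S t -> anchor_ok S h ->
  M.*2 <= gl -> gl <= H -> good_filling P S M t h gl (filling x0 H Phi t h gl).
Proof.
have [W hW] : exists W : option (G * G) * option (G * G) * nat -> nat -> G * G, forall x,
    anchor_ok S x.1.1 -> anchor_ok S x.1.2 -> M.*2 <= x.2 ->
    [/\ W x 0 = anchor_val x0 x.1.1, W x x.2 = anchor_val x0 x.1.2 &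
        good_filling P S M x.1.1 x.1.2 x.2 (W x)].
  apply: (@choice_fun _ _ (fun x f => anchor_ok S x.1.1 -> anchor_ok S x.1.2 -> M.*2 <= x.2 ->
    [/\ f 0 = anchor_val x0 x.1.1, f x.2 = anchor_val x0 x.1.2 &
        good_filling P S M x.1.1 x.1.2 x.2 f])) => -[[t h] gl] /=.
  case: (excluded_middle_informative (anchor_ok S t /\ anchor_ok S h /\ M.*2 <= gl)) => [[a [b d]]|no].
    by have [f [f0 fg fl fn fS]] := bridge symP hubS a b d; exists f.
  by exists (fun=> w) => a b d; case: no.
exists (fun tl hd => if (tl, hd) is (Some (j, t), Some (j', h)) then W (t, h, j + j') j else w).
move=> t h gl ht hh hg hH; have [W0 Wg Wf] := hW (t, h, gl) ht hh hg.
apply: good_filling_ext Wf => i hi; rewrite /filling.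
case: eqP => [->|i0]; first by rewrite W0.
case: eqP => [->|i1]; first by rewrite Wg.
rewrite /see (leq_trans hi hH) (_ : gl - i <= H); last lia.
by rewrite subnKC.
Qed.

(* Far from both anchors a filling may repeat [w] when it is a loop. *)
Lemma loop_filling : link P w w -> exists Phi, forall t h gl, anchor_ok S t -> anchor_ok S h ->
  M.*2 <= gl -> good_filling P S M t h gl (filling x0 M Phi t h gl).
Proof.
move=> ww.
have arr s : S s -> exists A : option (G * G) -> nat -> G * G, forall t, anchor_ok S t ->
  [/\ A t 0 = anchor_val x0 t, A t M = s, (forall i, i < M -> link P (A t i) (A t i.+1)),
      (forall i, 0 < i <= M -> nodeok P (A t i)) &
      (forall i, i <= M -> (t = None -> M <= i) -> S (A t i))].
  move=> hs; apply: (@choice_fun _ _ (fun t f => anchor_ok S t ->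
    [/\ f 0 = anchor_val x0 t, f M = s, (forall i, i < M -> link P (f i) (f i.+1)),
        (forall i, 0 < i <= M -> nodeok P (f i)) &
        (forall i, i <= M -> (t = None -> M <= i) -> S (f i))])) => t.
  case: (excluded_middle_informative (anchor_ok S t)) => ht; last by exists (fun=> w).
  by have [f hf] := arrive hubS ht hs (leqnn M); exists f.
have [A hA] := arr w (hub_w hubS).
have [B hB] := arr (swap w) (hub_swap hubS (hub_w hubS)).
(* Within [M] of the head, [mid] runs the mirror image of an arrival at [swap w]; farther away it
   repeats [w]. *)
pose mid (hd : option (nat * option (G * G))) :=
  if hd is Some (j, h) then if j < M then swap (B (omap (@swap G) h) j) else w else w.
exists (fun tl hd => if tl is Some (j, t) then if j < M then A t j else mid hd else mid hd).
move=> t h gl ht hh hg; set F := filling _ _ _ _ _ _.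
have hh' : anchor_ok S (omap (@swap G) h) by case: (h) hh => //= s; exact: (hub_swap hubS).
have [A0 AM Al An AS] := hA t ht; have [B0 BM Bl Bn BS] := hB _ hh'.
set h' := omap (@swap G) h in B0 BM Bl Bn BS.
have hv : swap (anchor_val x0 h') = anchor_val x0 h by rewrite /h'; case: (h) => //= s; rewrite swapK.
have FW i : M <= i -> i + M <= gl -> F i = w.
  move=> h1 h2; rewrite /F /filling ifN; last lia.
  rewrite ifN; last lia.
  have mw : mid (see M (gl - i) h) = w by rewrite /mid /see; case: ifP => // _; rewrite ifN //; lia.
  by rewrite mw /see; case: ifP => // _; case: ifP => //; lia.
have FA i : i <= M -> F i = A t i.
  move=> h1; case: (ltnP i M) => h2; last first.
    have -> : i = M by lia.
    by rewrite AM FW //; lia.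
  rewrite /F /filling; case: eqP => [->//|i0].
  rewrite ifN; last lia.
  by rewrite /see h1 h2.
have FB i : gl <= i + M -> i <= gl -> F i = swap (B h' (gl - i)).
  move=> h1 h2; case: (ltnP gl (i + M)) => h3; last first.
    have -> : gl - i = M by lia.
    by rewrite BM swapK FW //; lia.
  rewrite /F /filling ifN; last lia.
  case: eqP => [->|i1]; first by rewrite subnn B0.
  have mB : mid (see M (gl - i) h) = swap (B h' (gl - i)).
    by rewrite /mid /see ifT; [rewrite ifT //; lia | lia].
  rewrite mB /see; case: ifP => // h4; rewrite ifN //; lia.
split=> i hi.
- case: (ltnP i M) => h1; first by rewrite !FA //; [apply: Al | lia].
  case: (leqP (i.+1 + M) gl) => h2; first by rewrite !FW //; lia.
  rewrite !FB; try lia.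
  by rewrite link_swap // (_ : gl - i = (gl - i.+1).+1); [apply: Bl; lia | lia].
- case: (leqP i M) => h1; first by rewrite FA //; apply: An; lia.
  case: (leqP (i + M) gl) => h2; first by rewrite FW; [exact: (hub_node hubS (hub_w hubS)) | lia | lia].
  by rewrite FB; [rewrite nodeok_swap //; apply: Bn; lia | lia | lia].
- move=> ha hb; case: (leqP i M) => h1; first by rewrite FA //; apply: AS.
  case: (leqP (i + M) gl) => h2; first by rewrite FW; [exact: hub_w hubS | lia | lia].
  rewrite FB; [|lia|lia]; apply: (hub_swap hubS); apply: BS; first lia.
  by rewrite /h'; case: (h) hb => //= /(_ erefl); lia.
Qed.
End Fillings.

Lemma idn_valid c n ids z : valid_ids c n ids -> (0 <= z < Z.of_nat n)%Z -> 0 < idn (cfg n ids) z <= n ^ c.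
Proof.
case=> _ h hz; rewrite /idn /cfg; case: ifP => [_|]; last lia.
by apply: h; lia.
Qed.

Lemma idn_eq c n ids z z' : valid_ids c n ids -> (0 <= z < Z.of_nat n)%Z -> (0 <= z' < Z.of_nat n)%Z ->
  idn (cfg n ids) z = idn (cfg n ids) z' -> z = z'.
Proof.
case=> inj _ hz hz'; rewrite /idn /cfg; case: ifP => [_|]; last lia.
case: ifP => [_ /= e|]; last lia.
by have := inj _ _ _ _ e; lia.
Qed.

(** * The product of stride colours as a key *)

Section Colours.
Variables (G : finType) (P : nec G) (c n T k : nat) (A : seq (option nat) -> G * G).
Hypotheses (symP : nec_symmetric P) (c0 : 0 < c).
Hypothesis algA : forall ids o, valid_ids c n ids ->
  nec_sol P n (fun p => orient (o p) (A (orientw (o p) (win n T p ids)))).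
Hypothesis noloop : forall s, good P s -> ~~ link P s s.
Hypothesis nT : 4 * T + 9 <= n.

(** Identifiers along the progression of difference [j] in which [z] has index [T.+1]. *)
Definition stride (g : Z -> option nat) (j : nat) z (i : nat) : nat :=
  idn g (z + Z.of_nat j * (Z.of_nat i - Z.of_nat T.+1)).

Definition palette := {ffun 'I_(k.*2) -> (G * G) * (bool * bool)}.

(* Colours of adjacent nodes differ in the [j]-th component for the path whose
   edges join nodes at distance [j.+1]. *)
Definition colours (g : Z -> option nat) z : palette :=
  [ffun j : 'I_(k.*2) => colour T A (slice (stride g j.+1 z) 0 (window_size T).+2)].

Definition colour_key g z : nat := enum_rank (colours g z).

Definition margin := k.*2 * T.+1.

Lemma stride_range j z i : 0 < j <= k.*2 -> interior margin n z -> i <= T.*2.+2 ->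
  (0 <= z + Z.of_nat j * (Z.of_nat i - Z.of_nat T.+1) < Z.of_nat n)%Z.
Proof.
rewrite /interior /margin => hj hz hi.
have h : j * T.+1 <= k.*2 * T.+1 by rewrite leq_mul2r; lia.
nia.
Qed.

Lemma colour_key_lt g z : colour_key g z < #|{: palette}|.
Proof. exact: ltn_ord. Qed.

(** Nodes at distance [j] are adjacent on their progression of difference [j], so the component of
    index [j.-1] separates them. *)
Lemma colour_key_neq ids z z' : valid_ids c n ids -> interior margin n z -> interior margin n z' ->
  (z < z')%Z -> within k.*2 z z' -> colour_key (cfg n ids) z <> colour_key (cfg n ids) z'.
Proof.
move=> vi hz hz' lt nz /ord_inj/enum_rank_inj e.
pose j := Z.to_nat (z' - z).
have hj : j.-1 < k.*2 by move: nz; rewrite /within /j; lia.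
have ej : j.-1.+1 = j by rewrite /j; lia.
have := congr1 (fun f : palette => f (Ordinal hj)) e; rewrite !ffunE /= ej.
have sE : slice (stride (cfg n ids) j z') 0 (window_size T).+2 = slice (stride (cfg n ids) j z) 1 (window_size T).+2.
  rewrite /slice -[1]addn0 iotaDl -map_comp; apply: eq_map => i /=.
  by rewrite /stride; congr idn; rewrite /j; nia.
rewrite sE.
have rng i : i \in iota 0 (window_size T).+3 ->
    (0 <= z + Z.of_nat j * (Z.of_nat i - Z.of_nat T.+1) < Z.of_nat n)%Z.
  rewrite mem_iota /window_size => hi; case: (leqP i T.*2.+2) => hi'.
    by apply: stride_range => //; lia.
  have := @stride_range j z' T.*2.+2 ltac:(lia) hz' (leqnn _).
  have := @stride_range j z T.*2.+2 ltac:(lia) hz (leqnn _).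
  have -> : i = T.*2.+3 by lia.
  by rewrite /j; nia.
apply: (colour_neq c0 algA nT noloop) => [i i' /rng hi /rng hi'|i /rng hi].
- by move/(idn_eq vi hi hi'); rewrite /j; nia.
- exact: idn_valid.
Qed.

Lemma colour_key_inj ids z z' : valid_ids c n ids -> interior margin n z -> interior margin n z' ->
  within k.*2 z z' -> colour_key (cfg n ids) z = colour_key (cfg n ids) z' -> z = z'.
Proof.
move=> vi hz hz' nz e; case: (Z.lt_total z z') => [lt|[//|lt]].
- by case: (colour_key_neq vi hz hz' lt nz).
- by case: (@colour_key_neq ids z' z vi hz' hz lt _ (esym e)); move: nz; rewrite /within; lia.
Qed.

Lemma colour_key_local b e ids ids' z : valid_ids c n ids -> valid_ids c n ids' ->
  interior margin n z -> interior margin n (iso b e z) ->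
  agree b e margin z (cfg n ids) (cfg n ids') ->
  colour_key (cfg n ids) z = colour_key (cfg n ids') (iso b e z).
Proof.
move=> vi vi' hz hz' h; congr (nat_of_ord (enum_rank _)); apply/ffunP => j; rewrite !ffunE.
have ag i : i <= T.*2.+2 -> stride (cfg n ids) j.+1 z i =
    idn (cfg n ids') (iso b e (z + Z.of_nat j.+1 * (Z.of_nat i - Z.of_nat T.+1))).
  move=> hi; rewrite /stride /idn h // /within /margin.
  have hj : j.+1 * T.+1 <= k.*2 * T.+1 by rewrite leq_mul2r; have := ltn_ord j; lia.
  by nia.
case: b h hz' ag => h hz' ag.
(* A reflection reverses the progression, which [colour_rev] absorbs. *)
- have -> : slice (stride (cfg n ids) j.+1 z) 0 (window_size T).+2 =
            rev (slice (stride (cfg n ids') j.+1 (iso true e z)) 0 (window_size T).+2).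
    apply: (@eq_from_nth _ 0); first by rewrite size_rev !size_map.
    move=> i; rewrite size_map size_iota => hi.
    rewrite nth_rev size_map size_iota // !nth_slice //; last lia.
    rewrite ag; last by move: hi; rewrite /window_size; lia.
    by rewrite /stride; congr idn; rewrite /iso /window_size; move: hi; rewrite /window_size; nia.
  apply: colour_rev; last by rewrite size_map size_iota.
  rewrite map_inj_in_uniq ?iota_uniq // => i i'; rewrite !mem_iota /window_size => hi hi'.
  have r1 := @stride_range j.+1 _ i ltac:(have := ltn_ord j; lia) hz' ltac:(lia).
  have r2 := @stride_range j.+1 _ i' ltac:(have := ltn_ord j; lia) hz' ltac:(lia).
  by move/(idn_eq vi' r1 r2); nia.
- congr colour; apply/eq_in_map => i; rewrite mem_iota /window_size => hi.
  by rewrite ag; [rewrite /stride; congr idn; rewrite /iso; lia | lia].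
Qed.
End Colours.

(** * Solving the restricted problem *)

Lemma log_star_le n : log_star n <= (trunc_log 2 n).+1.
Proof.
rewrite /log_star; move: {1}n => k; elim: k n => // k IH n; rewrite /ls_fuel -/ls_fuel; case: ifP => // /negbT; rewrite -ltnNge => n1.
rewrite ltnS (leq_trans (IH _)) //.
have t0 : 0 < trunc_log 2 n by rewrite -(trunc_expnK 1 (isT : 1 < 2)) leq_trunc_log.
by apply: leq_trans (ltn_expl _ (isT : 1 < 2)) (trunc_logP _ t0).
Qed.

Lemma sublinear_radius T : bigO T log_star -> exists n, 0 < n /\ 4 * T n + 9 <= n.
Proof.
(* As [4 * C < X], [4 * T n] is at most [X * (2 * X + 7)], while [n], twice the square of
   [2 ^ (X + 2)], is at least [2 * (X + 3) ^ 2]. *)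
case=> C hC; pose X := 4 * C + 9; exists (2 ^ ((X + 2).*2.+1)).
rewrite expn_gt0; split=> //; set n := 2 ^ _.
have h1 : T n <= C * (2 * X + 7).
  apply: leq_trans (hC n) _; rewrite leq_mul2l; apply/orP; right.
  by have := log_star_le n; rewrite {2}/n trunc_expnK // => h; lia.
have h2 : 2 * ((X + 3) * (X + 3)) <= n.
  by rewrite /n expnS leq_mul2l /= -addnn expnD; apply: leq_mul; have := ltn_expl (X + 2) (isT : 1 < 2); lia.
apply: leq_trans h2; rewrite /X in h1 *; nia.
Qed.

Section Main.
Variables (G : finType) (P : nec G) (c : nat).
Hypotheses (symP : nec_symmetric P) (c0 : 0 < c).

Lemma solvable_sol T : solvable_in c (nec_sol P) T -> forall n, 0 < n -> exists lab, nec_sol P n lab.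
Proof.
case=> A hA n n0; eexists; apply: (hA n succn (fun=> false)) => //.
split=> [p q _ _ [] //|p hp].
by have := n_le n c0; lia.
Qed.

(** The iterated-logarithm bound supplies a length at which [T] is small enough for [out_good]. *)
Lemma good_ex : solvable_O c (nec_sol P) log_star -> exists w, good P w.
Proof.
case=> T [bT [A hA]]; have [n [n0 hn]] := sublinear_radius bT.
exists (out (A n) false (iota 1 (window_size (T n)))).
apply: (out_good c0 (fun ids o vi => hA n ids o n0 vi) hn).
split; rewrite ?iota_uniq ?size_iota // => x; rewrite !mem_iota => hx.
have := n_le n c0; move: (n ^ c) hx => N; rewrite /window_size; lia.
Qed.

Variables (w : G * G) (S : pred (G * G)) (M : nat) (x0 : G).
Hypotheses (hubS : hub P w S M x0) (M0 : 0 < M).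
Hypothesis solvP : forall n, 0 < n -> exists lab, nec_sol P n lab.
Let R := M.*2.
Let k := M.*2.*2.

Lemma rule_brute n : 0 < n -> rule_for P S R c n n.
Proof.
move=> n0.
have R0 : 0 < R by rewrite /R; lia.
have [lab hl] := checked_sol symP hubS (leqnn R) R0 solvP n0.
apply: (rule_small c symP hubS R0 _ M0 n0 (sol := lab)); first by rewrite /R; lia.
by apply/restr_solP => //; exact: (hub_swap hubS).
Qed.

(** With identifiers as keys, [Kmax] grows with [n]; this is harmless because [loop_filling] puts no
    upper bound on a gap. *)
Lemma rule_loop : link P w w -> exists K, forall n, 0 < n -> rule_for P S R c n K.
Proof.
move=> ww; have [Phi hPhi] := loop_filling symP hubS M0 ww.
exists (M + ((M.*2 + k).+1 + 1) + (2 + k.*2)) => n n0.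
case: (ltnP (2 + k.*2) n) => hn; last by apply: rule_for_mono (rule_brute n0); lia.
apply: rule_for_mono (_ : M + ((M.*2 + k).+1 + (1 + 0)) <= _) _; first lia.
have [R0 MR] : 0 < R /\ M <= R by rewrite /R; lia.
apply: (rule_large symP hubS R0 MR M0 (BIG := (n ^ c).+1) (inner := idn) (Phi := Phi)) => //.
- by move=> b e ids ids' z _ _ _ _ h; rewrite /idn h //; exact: within0.
- move=> ids z z' vi hz hz' _; apply: (idn_eq vi); move: hz hz'; rewrite /interior; lia.
- move=> ids z vi hz; rewrite ltnS; have := @idn_valid c n ids z vi; rewrite /interior in hz.
  by case/(_ ltac:(lia))/andP.
- by move=> t h gl ht hh hg _; apply: hPhi.
Qed.

(** [B] depends only on [G] and [k], and [D] is of order [T.+1], so the horizon [H] can cover every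
    gap within the same order. Paths shorter than a fixed multiple of [T.+1] are solved by brute
    force. *)
Lemma rule_colours : (forall s, good P s -> ~~ link P s s) ->
  exists K, forall n T, 0 < n -> forall A : seq (option nat) -> G * G,
  (forall ids o, valid_ids c n ids ->
    nec_sol P n (fun p => orient (o p) (A (orientw (o p) (win n T p ids))))) ->
  rule_for P S R c n (K * T.+1).
Proof.
move=> noloop; pose B := #|{: palette G k}|.
exists (8 * k + 9 + (k * (B + 2 * k + 2)).+1 + (M.*2 + k).+1 + 4 * k) => n T n0 A hA.
case: (ltnP n ((8 * k + 9) * T.+1)) => hn.
  by apply: rule_for_mono (rule_brute n0); nia.
pose D := k.*2 * T.+1; pose H := (k * (B + D.+2)).+1.
have [Phi hPhi] := bridge_filling symP hubS M0 H.
apply: rule_for_mono (_ : H + ((M.*2 + k).+1 + (D + D)) <= _) _.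
  by rewrite /H /D; clear; nia.
have nT : 4 * T + 9 <= n by nia.
have kp : 0 < k by rewrite /k; lia.
have [R0 MR] : 0 < R /\ M <= R by rewrite /R; lia.
apply: (rule_large symP hubS R0 MR M0 (BIG := B) (inner := colour_key T k A) (Phi := Phi)) => //.
- by rewrite /D; nia.
- by rewrite -/k /D; nia.
- by move=> b e ids ids' z; apply: (colour_key_local A c0 nT).
- by move=> ids z z'; apply: (colour_key_inj (k := k) c0 hA noloop nT).
- by move=> ids z _ _; apply: colour_key_lt.
Qed.

Lemma restr_solvable f : link P w w \/ (forall s, good P s -> ~~ link P s s) ->
  solvable_O c (nec_sol P) f -> solvable_O c (lcl_sol (restr P S R)) f.
Proof.
move=> cases [T [[C hC] [A hA]]].
have ext n lab lab' : (forall p, p < n -> lab p = lab' p) ->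
  lcl_sol (restr P S R) n lab -> lcl_sol (restr P S R) n lab' by exact: restr_sol_ext.
case: cases => [/rule_loop [K hK]|/rule_colours [K hK]].
- exists (fun=> K); split; first by exists K => n; nia.
  by apply: solvable_local => // n n0; exact: hK.
- exists (fun n => K * (T n).+1); split.
    by exists (K * C.+1) => n; rewrite -mulnA leq_mul2l; have := hC n; nia.
  apply: solvable_local => // n n0; apply: (hK n (T n) n0 (A n)) => ids o vi; exact: hA.
Qed.
End Main.

Theorem theoremB1 (G : finType) (P : nec G) (c : nat) :
  0 < c -> nec_symmetric P ->
  solvable_O c (nec_sol P) log_star ->
  exists P' : lcl G,
    [/\ (forall f : nat -> nat,
           solvable_O c (nec_sol P) f <-> solvable_O c (lcl_sol P') f),
        (forall n (lab : nat -> G * G), 0 < n -> lcl_sol P' n lab -> nec_sol P n lab) &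
        O1_mendable P'].
Proof.
move=> c0 symP solv.
(* A good state that can follow itself is preferred; when there is none, no good state has a loop,
   as the colouring requires. *)
have [w gw cases] : exists2 w, good P w & link P w w \/ (forall s, good P s -> ~~ link P s s).
  case: (excluded_middle_informative (exists2 w, good P w & link P w w)) => [[w gw lw]|no].
    by exists w => //; left.
  have [w gw] := good_ex c0 solv; exists w => //; right => s gs.
  by apply/negP => ls; apply: no; exists s.
have [S [M [x0 [M0 hubS]]]] := good_hub symP gw.
have solvP : forall n, 0 < n -> exists lab, nec_sol P n lab.
  by case: solv => T [_ /(solvable_sol c0)].
have R0 : 0 < M.*2 by lia.
have sub n lab : 0 < n -> lcl_sol (restr P S M.*2) n lab -> nec_sol P n lab.
  by apply: restr_sol_nec => //; exact: (hub_swap hubS).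
(* Radius [M.*2] keeps the boundaries of a mended block far enough apart for a bridge. *)
exists (restr P S M.*2); split=> //.
- move=> f; split; first exact: (restr_solvable symP c0 hubS M0 solvP cases).
  case=> T [bT [A hA]]; exists T; split=> //; exists A => n ids o n0 vi.
  by apply: sub => //; exact: hA.
- exact: (restr_mendable symP hubS (leqnn _) R0 solvP).
Qed.
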